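(* Let $\mathcal M=(S,S_\Box,S_\bigcirc,\longrightarrow,P)$ be a universally transient countable MDP (possibly infinitely branching), let $Col:S\to\{0,1,2\}$ be a coloring and let $\varphi=\mathtt{Parity}(Col)$. There exists an MD strategy $\sigma'$ that is optimal for all states that have an optimal strategy: for every $s\in S$, if there exists a strategy $\sigma$ with $\mathcal P_{\mathcal M,s,\sigma}(\varphi)=\mathtt{val}_{\mathcal M,\varphi}(s)$, then $\mathcal P_{\mathcal M,s,\sigma'}(\varphi)=\mathtt{val}_{\mathcal M,\varphi}(s)$.
   Context: MDPs: an MDP is a tuple $\mathcal M=(S,S_\Box,S_\bigcirc,\longrightarrow,P)$ where $S$ is a countable set of states partitioned into controlled states $S_\Box$ and random states $S_\bigcirc$, $\longrightarrow\subseteq S\times S$ is a transition relation in which every state has at least one (possibly infinitely many) successor, and $P$ assigns to each random state $s$ a probability distribution $P(s)$ on its successors. A run is an infinite sequence $s_0s_1\cdots$ with $s_i\longrightarrow s_{i+1}$ for all $i$. A strategy is a function $\sigma:S^*S_\Box\to\mathcal D(S)$ (where $\mathcal D(S)$ is the set of probability distributions on $S$) assigning to each finite sequence $\rho s$ ending in a controlled state $s$ a distribution over successors of $s$. A strategy $\sigma$ and initial state $s_0$ induce the usual probability measure $\mathcal P_{\mathcal M,s_0,\sigma}$ on infinite sequences starting in $s_0$ (at random states the successor is drawn according to $P$). A strategy is memoryless deterministic (MD) if it is given by a function $\sigma:S_\Box\to S$ choosing a successor of each controlled state. For a measurable objective $\varphi$ (a set of runs), $\mathtt{val}_{\mathcal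 M,\varphi}(s)=\sup_\sigma \mathcal P_{\mathcal M,s,\sigma}(\varphi)$, the supremum over all strategies. $\mathtt{Parity}(Col)$ is the set of runs such that the largest color occurring infinitely often along the run is even. $\mathtt{Transience}$ is the set of runs that visit no state infinitely often. $\mathcal M$ is universally transient if $\mathcal P_{\mathcal M,s_0,\sigma}(\mathtt{Transience})=1$ for all states $s_0$ and all strategies $\sigma$. *)

(* Defs.v *)
From HB Require Import structures.
From mathcomp Require Import all_boot all_order all_algebra.
From mathcomp Require Import all_classical all_reals all_analysis.
From mathcomp Require Import ring lra.

Set Implicit Arguments.
Unset Strict Implicit.
Unset Printing Implicit Defensive.

Import Order.TTheory GRing.Theory Num.Theory.
Import numFieldNormedType.Exports.

Local Open Scope classical_set_scope.
Local Open Scope ring_scope.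

Definition is_distr (R : realType) (S : countType) (A : set S) (p : S -> R) :=
  [/\ forall t, 0 <= p t,
      forall t, p t != 0 -> A t &
      \esum_(t in [set: S]) (p t)%:E = 1%E].

Definition cylinder (S : countType) (w : seq S) : set (nat -> S) :=
  [set r | mkseq r (size w) = w].

(* All the sequences, not only those that start in [s0]. The index [s0] is
   there because [g_sigma_algebraType] needs a pointed type: it provides the
   point without excluding an empty state space. *)
Definition sequences (S : countType) (s0 : S) : Type := nat -> S.
HB.instance Definition _ (S : countType) (s0 : S) :=
  gen_eqMixin (sequences s0).
HB.instance Definition _ (S : countType) (s0 : S) :=
  gen_choiceMixin (sequences s0).
HB.instance Definition _ (S : countType) (s0 : S) :=
  isPointed.Build (sequences s0) (fun _ : nat => s0).

Notation path_space s0 :=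
  (g_sigma_algebraType (range (@cylinder _) : set (set (sequences s0)))).

Section unif.
Variable R : realType.

Definition unif : set (measurableTypeR R) -> \bar R :=
  mrestr (@lebesgue_measure R) (measurable_itv `[0, 1[).
HB.instance Definition _ := Measure.on unif.

Let unif_setT : unif setT = 1%E.
Proof.
by rewrite /unif /mrestr setTI lebesgue_measure_itv/= lte_fin ltr01 oppr0 adde0.
Qed.
HB.instance Definition _ :=
  Measure_isProbability.Build _ _ _ unif unif_setT.

End unif.

Section path_measure.
Variables (R : realType) (S : countType).
Implicit Types (rho w : seq S) (s t : S) (p : S -> R) (x : R).

(* [k rho s t] is the probability of moving to [t] after [rcons rho s]. *)
Fixpoint path_prob (k : seq S -> S -> S -> R) rho s w : R :=
  if w is t :: w' then k rho s t * path_prob k (rcons rho s) t w' else 1.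

Let q (p : S -> R) (i : nat) : R := if pickle_inv i is Some t then p t else 0.
Let F (p : S -> R) (n : nat) : R := \sum_(i < n) q p i.

Let q_ge0 p i : (forall t, 0 <= p t) -> 0 <= q p i.
Proof. by move=> p0; rewrite /q; case: pickle_inv. Qed.

Let q_pickle p t : q p (pickle t) = p t.
Proof. by rewrite /q pickleK_inv. Qed.

Let FS p n : F p n.+1 = F p n + q p n.
Proof. by rewrite /F big_ord_recr. Qed.

Let F_mono p : (forall t, 0 <= p t) -> {homo F p : m n / (m <= n)%N >-> m <= n}.
Proof.
move=> p0; apply: homo_leq => //; first exact: le_trans.
by move=> n; rewrite FS lerDl q_ge0.
Qed.

Let q_series p : (forall t, 0 <= p t) ->
  \esum_(t in [set: S]) (p t)%:E = (\sum_(0 <= i <oo) (q p i)%:E)%E.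
Proof.
move=> p0; rewrite nneseries_esumT; last by move=> i; rewrite lee_fin q_ge0.
rewrite [RHS](esumID (range (@pickle S))) //; last first.
  by move=> i _; rewrite lee_fin q_ge0.
rewrite [X in (_ + X)%E]esum1 ?adde0; last first.
  move=> i [_ /= ni]; rewrite /q.
  have := @pickle_invK S i; case: (pickle_inv i) => [t /= ti|//].
  by exfalso; apply: ni; exists t.
rewrite setTI (@reindex_esum _ _ _ [set: S] (range (@pickle S)) pickle).
- by apply: eq_esum => t _; rewrite q_pickle.
- split=> [t _|? ? _ _ /(pcan_inj (@pickleK _))//|_ [t _ <-]];
  by exists t.
Qed.

Let F_sup p : (forall t, 0 <= p t) -> \esum_(t in [set: S]) (p t)%:E = 1%E ->
  F p @ \oo --> (1 : R).
Proof.
move=> p0 p1.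
suff : (fun n => (F p n)%:E) @ \oo --> 1%:E by move/fine_cvg.
rewrite -p1 q_series//.
have -> : (fun n => (F p n)%:E) = (fun n => \sum_(0 <= i < n) (q p i)%:E)%E.
  by apply/funext => n; rewrite /F big_mkord sumEFin.
by apply: is_cvg_nneseries => i _ _; rewrite lee_fin q_ge0.
Qed.

Let F_le1 p n : (forall t, 0 <= p t) ->
  \esum_(t in [set: S]) (p t)%:E = 1%E -> F p n <= 1.
Proof.
move=> p0 p1; have := F_sup p0 p1 => c.
rewrite -(cvg_lim (@Rhausdorff R) c).
by apply: nondecreasing_cvgn_le; [exact: F_mono|apply/cvg_ex; exists 1].
Qed.

(* The path measure is built as the image of Lebesgue measure on [0, 1[: the
   interval is cut into consecutive slots of lengths [p t], one for each
   successor [t], and the point is rescaled within its slot before the next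
   step. *)
Let slot p x t := F p (pickle t) <= x < F p (pickle t) + p t.

Let slot_ex p x : (forall t, 0 <= p t) ->
  \esum_(t in [set: S]) (p t)%:E = 1%E -> 0 <= x < 1 -> exists t, slot p x t.
Proof.
move=> p0 p1 /andP[x0 x1].
have [n Fn] : exists n, x < F p n.
  have /cvgrPdist_lt/(_ (1 - x)) := F_sup p0 p1.
  rewrite subr_gt0 => /(_ x1) [n _ /(_ n (leqnn n))] /=.
  by rewrite ger0_norm ?subr_ge0 ?F_le1// => ?; exists n; lra.
have [[|m] xm mmin] := ex_minnP (ex_intro (fun n => x < F p n) n Fn).
  by move: xm; rewrite /F big_ord0; lra.
have Fm : F p m <= x.
  by rewrite leNgt; apply/negP => /mmin; rewrite ltnn.
move: xm; rewrite FS; rewrite {1}/q.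
have := @pickle_invK S m; case: (pickle_inv m) => [t /= tm|_] xm; last first.
  by move: xm; lra.
by exists t; rewrite /slot tm; apply/andP.
Qed.

Let slot_uniq p x t u : (forall t, 0 <= p t) -> slot p x t -> slot p x u -> t = u.
Proof.
move=> p0; wlog tu : t u / (pickle t < pickle u)%N.
  move=> h tx ux; case: (ltngtP (pickle t) (pickle u)) => tu.
  - exact: h.
  - by apply/esym; exact: h.
  - exact: (pcan_inj (@pickleK S)) tu.
move=> /andP[_ xt] /andP[ux _]; have := F_mono p0 tu.
by rewrite FS q_pickle => ?; exfalso; lra.
Qed.

Variables (k : seq S -> S -> S -> R) (A : seq S -> S -> set S).
Hypothesis kP : forall rho s, is_distr (A rho s) (k rho s).

Let k0 rho s t : 0 <= k rho s t. Proof. by have [] := kP rho s. Qed.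

Let k1 rho s : \esum_(t in [set: S]) (k rho s t)%:E = 1%E.
Proof. by have [] := kP rho s. Qed.

Let pick rho s x : S := xget s (fun t => slot (k rho s) x t).

Let pickP rho s x : 0 <= x < 1 -> slot (k rho s) x (pick rho s x).
Proof.
by move=> x01; rewrite /pick; case: xgetP => // nP;
  have [t] := slot_ex (k0 rho s) (k1 rho s) x01; move=> /nP.
Qed.

Let rest rho s x := let t := pick rho s x in
  (x - F (k rho s) (pickle t)) / k rho s t.

Let slot_rest p x t : slot p x t -> 0 <= (x - F p (pickle t)) / p t < 1.
Proof.
move=> /andP[h1 h2]; have p0 : 0 < p t by lra.
by rewrite divr_ge0 ?subr_ge0 ?(ltW p0)//= ltr_pdivrMr// mul1r; lra.
Qed.

Let Fixpoint traj rho s x (n : nat) : S :=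
  if n is m.+1 then traj (rcons rho s) (pick rho s x) (rest rho s x) m else s.

Let Fixpoint lo rho s w : R :=
  if w is t :: w' then
    F (k rho s) (pickle t) + k rho s t * lo (rcons rho s) t w'
  else 0.

Let path_prob_ge0 w : forall rho s, 0 <= path_prob k rho s w.
Proof. by elim: w => //= t w IH rho s; rewrite mulr_ge0. Qed.

Let lo_bound w : forall rho s, 0 <= lo rho s w /\
  lo rho s w + path_prob k rho s w <= 1.
Proof.
elim: w => [|t w IH] rho s /=; first by rewrite lexx add0r.
have [l0 l1] := IH (rcons rho s) t; split.
  rewrite addr_ge0 ?mulr_ge0//; rewrite /F sumr_ge0// => i _.
  exact: q_ge0.
rewrite -addrA -mulrDr.
apply: (@le_trans _ _ (F (k rho s) (pickle t).+1)); last exact: F_le1.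
by rewrite FS q_pickle lerD2l ler_piMr.
Qed.

Let traj_cylinder w : forall rho s x, 0 <= x < 1 ->
  (mkseq (traj rho s x) (size w).+1 == s :: w) =
  (lo rho s w <= x < lo rho s w + path_prob k rho s w).
Proof.
have mk T (f : nat -> T) n : mkseq f n.+1 = f 0%N :: mkseq (f \o succn) n.
  by rewrite /mkseq /= -[1%N]addn0 iotaDl -map_comp.
elim: w => [|t w IH] rho s x x01; first by rewrite /= add0r x01 eqxx.
rewrite mk /= eqseq_cons eqxx /= -/(size (t :: w)).
have -> : traj rho s x \o succn
        = traj (rcons rho s) (pick rho s x) (rest rho s x) by [].
have sp := pickP rho s x01.
have [tE|tN] := eqVneq (pick rho s x) t.
  rewrite tE in sp *; rewrite IH; last by rewrite /rest tE; exact: slot_rest.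
  rewrite /rest tE; have kt : 0 < k rho s t by move: sp => /andP[]; lra.
  rewrite ler_pdivlMr// ltr_pdivrMr//.
  by congr (_ && _); apply/idP/idP => ?; nra.
transitivity false; first by rewrite mk eqseq_cons /= (negPf tN).
apply/esym/negP => h; case/eqP: tN; apply: slot_uniq sp _ => //.
have [l0 l1] := lo_bound w (rcons rho s) t.
have := k0 rho s t; move: h; rewrite /slot => /andP[h1 h2] kt.
apply/andP; split; nra.
Qed.

Definition draw s0 (x : measurableTypeR R) : path_space s0 :=
  if 0 <= x < 1 then traj [::] s0 x else fun _ => s0.

Let draw_cylinder s0 w : draw s0 @^-1` cylinder (s0 :: w) `&` [set` `[0, 1[] =
  [set` `[lo [::] s0 w, lo [::] s0 w + path_prob k [::] s0 w[].
Proof.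
have [l0 l1] := lo_bound w [::] s0.
apply/seteqP; split => x /=; rewrite !in_itv/= /draw.
  by move=> [+ x01]; rewrite x01 /cylinder /= => /eqP; rewrite traj_cylinder.
move=> xw; have x01 : 0 <= x < 1 by move: xw; lra.
by split=> //; rewrite x01 /cylinder; apply/eqP; rewrite traj_cylinder.
Qed.

Let draw0 s0 x : draw s0 x 0%N = s0.
Proof. by rewrite /draw; case: ifP. Qed.

Let measurable_draw s0 : measurable_fun setT (draw s0).
Proof.
apply: (@measurability _ _ _ (path_space s0) setT (draw s0)
  (range (@cylinder S))) => //.
move=> _ [_ [w _ <-] <-]; rewrite setTI.
case: w => [|s w].
  by rewrite (_ : _ @^-1` _ = setT)//; apply/seteqP; split.
have [->{s}|ss0] := eqVneq s s0; last first.
  rewrite (_ : _ @^-1` _ = set0)//; apply/seteqP; split=> x //=.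
  by rewrite /cylinder /= => -[]; rewrite draw0 => /esym/eqP; rewrite (negPf ss0).
rewrite -[X in measurable X]setIT -(setUv [set` `[0, 1[]) setIUr.
apply: measurableU.
  by rewrite draw_cylinder; exact: measurable_itv.
have mC : measurable (~` [set` `[(0 : R), 1[]).
  by apply: measurableC; exact: measurable_itv.
have [c|c] := pselect (cylinder (s0 :: w) (fun _ => s0)).
  rewrite (_ : _ `&` _ = ~` [set` `[0, 1[])//.
  apply/seteqP; split=> x; first by case.
  by move=> xN; split=> //; move/negP: xN; rewrite /= in_itv/= /draw => /negPf ->.
rewrite (_ : _ `&` _ = set0)//; apply/seteqP; split=> x //= [+ /negP].
by rewrite in_itv/= /draw => + /negPf xN; rewrite xN.
Qed.

HB.instance Definition _ s0 :=
  isMeasurableFun.Build _ _ _ _ (draw s0) (@measurable_draw s0).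

Lemma path_measure_exists s0 : exists mu : probability (path_space s0) R,
  forall w, mu (cylinder (s0 :: w)) = (path_prob k [::] s0 w)%:E.
Proof.
exists (distribution (@unif R) (draw s0)) => w.
rewrite /distribution /pushforward /= /unif /mrestr draw_cylinder.
rewrite lebesgue_measure_itv/= lte_fin.
have := path_prob_ge0 w [::] s0; rewrite le_eqVlt => /orP[/eqP <-|p0].
  by rewrite addr0 ltxx.
by rewrite ltrDl p0 -EFinB; congr (_%:E); lra.
Qed.

Lemma path_measure_unique s0 (mu nu : probability (path_space s0) R) :
  (forall w, mu (cylinder (s0 :: w)) = (path_prob k [::] s0 w)%:E) ->
  (forall w, nu (cylinder (s0 :: w)) = (path_prob k [::] s0 w)%:E) ->
  forall E, measurable E -> mu E = nu E.
Proof.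
move=> muE nuE.
pose G := range (@cylinder S) `|` [set set0] : set (set (path_space s0)).
have mcyl w : measurable (cylinder w : set (path_space s0)).
  by apply: sub_sigma_algebra; exists w.
have cyl0 : cylinder [::] = [set: path_space s0] by apply/seteqP; split.
have null (P : probability (path_space s0) R) s w :
    P (cylinder [:: s0]) = 1%E -> s != s0 -> P (cylinder (s :: w)) = 0%E.
  move=> P1 ss0; apply/eqP; rewrite eq_le measure_ge0 andbT.
  have <- : P (~` cylinder [:: s0]) = 0%E.
    by rewrite probability_setC ?P1 ?subee//; exact: mcyl.
  apply: le_measure; rewrite ?inE; first exact: mcyl.
    by apply: measurableC; exact: mcyl.
  move=> r; rewrite /cylinder /= => -[r0 _] [r0'].
  by move: ss0; rewrite -r0 r0' eqxx.
have cap u v : (size u <= size v)%N -> G (cylinder u `&` cylinder v).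
  move=> uv; have [uE|uN] := eqVneq (take (size u) v) u.
    left; exists v => //; apply/seteqP; split=> r; last by case.
    rewrite /cylinder /= => rv; split=> //; rewrite -{2}uE -rv.
    by rewrite -map_take take_iota (minn_idPl uv).
  right; apply/seteqP; split=> r //=; rewrite /cylinder /= => -[ru rv].
  case/eqP: uN; rewrite -{1}rv -[RHS]ru.
  by rewrite -map_take take_iota (minn_idPl uv).
move=> E mE.
apply: (@g_sigma_algebra_measure_unique _ _ _ G _ (fun _ => setT)) => //.
- by move=> X [[w _ <-]|->]; [exact: mcyl|exact: measurable0].
- by move=> _; left; exists [::].
- by rewrite bigcup_const//; exists 0%N.
- move=> X Y [[u _ <-]|->]; last by rewrite set0I; right.
  move=> [[v _ <-]|->]; last by rewrite setI0; right.
  by case: (leqP (size u) (size v)) => [|/ltnW] uv; [|rewrite setIC]; exact: cap.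
- move=> X [[[|s w] _ <-]|->]; last by rewrite !measure0.
    rewrite cyl0; transitivity (1%E : \bar R); first exact: probability_setT.
    by apply/esym; exact: probability_setT.
  have [->|ss0] := eqVneq s s0; first exact: etrans (muE w) (esym (nuE w)).
  transitivity (0%E : \bar R); first exact: null (muE [::]) ss0.
  by apply/esym; exact: null (nuE [::]) ss0.
- move=> _; apply: (@le_lt_trans _ _ 1%E); last exact: ltry.
  exact: probability_le1.
- by apply: sub_sigma_algebra2 mE => A' ?; left.
Qed.

End path_measure.

Record mdp (R : realType) (S : countType) := MDP {
  controlled : pred S;
  step : S -> S -> Prop;
  step_total : forall s, exists t, step s t;
  (* meaningful at random, that is not controlled, states only *)
  random_step : S -> S -> R;
  random_stepP : forall s, ~~ controlled s -> is_distr (step s) (random_step s)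
}.

(* [strat_distr rho s] is the distribution chosen after the history
   [rcons rho s]; it is meaningful at controlled [s] only. *)
Record strategy (R : realType) (S : countType) (M : mdp R S) := Strategy {
  strat_distr : seq S -> S -> S -> R;
  strat_distrP : forall rho s, controlled M s ->
    is_distr (step M s) (strat_distr rho s)
}.

Section mdp_theory.
Variables (R : realType) (S : countType) (M : mdp R S).
Implicit Types (sigma : strategy M) (s : S) (r : nat -> S).

Definition is_MD sigma := exists f : S -> S, forall rho s, controlled M s ->
  forall t, strat_distr sigma rho s t = (t == f s)%:R.

Definition next_distr sigma (rho : seq S) s : S -> R :=
  if controlled M s then strat_distr sigma rho s else random_step M s.

Lemma next_distrP sigma rho s : is_distr (step M s) (next_distr sigma rho s).
Proof.
rewrite /next_distr; case: ifPn => [cs|rs].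
  exact: strat_distrP.
exact: random_stepP.
Qed.

(* By [path_measure_unique], [Pr_cylinder] determines this measure on the
   measurable sets. *)
Definition Pr sigma s0 : probability (path_space s0) R :=
  sval (cid (path_measure_exists (next_distrP sigma) s0)).

Lemma Pr_cylinder sigma s0 w :
  Pr sigma s0 (cylinder (s0 :: w)) = (path_prob (next_distr sigma) [::] s0 w)%:E.
Proof. exact: (svalP (cid (path_measure_exists (next_distrP sigma) s0))). Qed.

Definition value (phi : set (nat -> S)) s : \bar R :=
  ereal_sup [set Pr sigma s phi | sigma in [set: strategy M]].

Definition run : set (nat -> S) := [set r | forall i, step M (r i) (r i.+1)].

Definition inf_often (A : set S) r := forall m, exists n, (m <= n)%N /\ A (r n).

Definition parity d (col : S -> 'I_d) : set (nat -> S) :=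
  [set r | run r /\ exists c : 'I_d,
    [/\ ~~ odd c, inf_often [set s | col s = c] r &
        forall c' : 'I_d, inf_often [set s | col s = c'] r -> (c' <= c)%N]].

Definition transience : set (nat -> S) :=
  [set r | run r /\ forall s, ~ inf_often [set s] r].

Definition universally_transient :=
  forall sigma s, Pr sigma s transience = 1%E.

End mdp_theory.

(* Main.v *)
Require Import Defs.
From HB Require Import structures.
From mathcomp Require Import all_boot all_order all_algebra.
From mathcomp Require Import all_classical all_reals all_analysis.
From mathcomp Require Import ring lra zify.

(* Conditioning on winning (a Doob transform by the value) makes every state
   that has an optimal strategy win almost surely, so it suffices to find a
   memoryless policy that wins almost surely in the conditioned process.

   Universal transience bounds the return probabilities of each state away
   from 1 uniformly in the strategy. Hence there is a bounded potential that
   pays for a positive loss at each visit of each state, and staying in color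
   0 forever has a memoryless strategy that is optimal up to 1/8, even with
   infinite branching. Impose this strategy where it is good (the set A). An
   almost surely winning strategy visits color 2, or states where the safety
   value is close to 1 (deep in A), and this remains true after imposing the
   safe actions. Ornstein's plastering gives a memoryless policy that reaches
   these targets almost surely from everywhere. Deep in A it stays in A, thus
   in color 0, with probability at least 1/2; so almost surely color 2 is
   visited infinitely often, or color 0 is kept from some point on.

   Values of reachability and safety are treated as extremal sub- and
   superharmonic functions, which avoids composing strategies. *)

Set Implicit Arguments.
Unset Strict Implicit.
Unset Printing Implicit Defensive.

Import Order.TTheory GRing.Theory Num.Theory.
Import numFieldNormedType.Exports.

Local Open Scope classical_set_scope.
Local Open Scope ring_scope.

(** * Expectations under countable distributions *)

(** With infinite branching neither reachability nor safety values need be attained, and the two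
    need different remedies. For reachability a discount below 1 suffices: discounted values
    increase to the undiscounted one, and a discounted value is attained up to a slightly weaker
    discount. A discount would destroy safety, since it kills every infinite stay; there the losses
    must be summable along the run. The potential ensures this, because transience makes the visits
    to each state few on average, uniformly in the strategy. Imposing actions could spoil
    reachability elsewhere. A zero-one law controls this: reach values bounded below by one positive
    constant at all states are all equal to 1. So it is enough to keep them above 1/2, and imposing
    actions only where they guarantee more than 1/2 costs at most a factor 2. The constants: a
    safety value 7/8 minus a potential of at most 1/8 leaves 3/4, and the positive part of
    [2 * h - 1], which vanishes where no action is imposed, sends 3/4 to 1/2. *)

Section expectation.
Variables (R : realType) (S : countType).
Implicit Types (p f g : S -> R).

Definition dist p := is_distr [set: S] p.

Definition bnd f := exists K, forall t, `|f t| <= K.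

Definition enc f (i : nat) : R := if pickle_inv i is Some t then f t else 0.

(* A series rather than [esum], because [f] may change sign. *)
Definition Ex p f : R := limn (series (enc (fun t => p t * f t))).

Lemma is_distr_dist A p : is_distr A p -> dist p.
Proof. by case=> p0 _ p1; split. Qed.

Lemma dist_ge0 p t : dist p -> 0 <= p t.
Proof. by case. Qed.

Lemma enc_pickle f t : enc f (pickle t) = f t.
Proof. by rewrite /enc pickleK_inv. Qed.

Lemma cvg_series_enc p : (forall t, 0 <= p t) ->
  (fun n => (series (enc p) n)%:E) @ \oo --> \esum_(t in [set: S]) (p t)%:E.
Proof.
move=> p0; have q0 i : 0 <= enc p i by rewrite /enc; case: pickle_inv.
have -> : (fun n => (series (enc p) n)%:E) =
    (fun n => \sum_(0 <= i < n) (enc p i)%:E)%E.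
  by apply/funext => n; rewrite /series sumEFin.
suff -> : \esum_(t in [set: S]) (p t)%:E = (\sum_(0 <= i <oo) (enc p i)%:E)%E.
  by apply: is_cvg_nneseries => i _ _; rewrite lee_fin.
rewrite [RHS]nneseries_esumT; last by move=> i; rewrite lee_fin.
rewrite [RHS](esumID (range (@pickle S))) //; last first.
  by move=> i _; rewrite lee_fin.
rewrite [X in (_ + X)%E]esum1 ?adde0; last first.
  move=> i [_ /= ni]; rewrite /enc.
  have := @pickle_invK S i; case: (pickle_inv i) => [t /= ti|//].
  by exfalso; apply: ni; exists t.
rewrite setTI (@reindex_esum _ _ _ [set: S] (range (@pickle S)) pickle).
- by apply: eq_esum => t _; rewrite enc_pickle.
- split=> [t _|? ? _ _ /(pcan_inj (@pickleK _))//|_ [t _ <-]];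
  by exists t.
Qed.

Lemma dist_series p : dist p -> series (enc p) @ \oo --> (1 : R).
Proof. by move=> [/cvg_series_enc + _ p1]; rewrite p1 => /fine_cvg. Qed.

Lemma Ex_cvg p f : dist p -> bnd f -> cvgn (series (enc (fun t => p t * f t))).
Proof.
move=> dp [K fK]; apply: normed_cvg.
have K0 : forall t : S, 0 <= K by move=> t; apply: le_trans (fK t).
apply: (@series_le_cvg _ _ (fun i => enc p i * `|K|)).
- by move=> i; rewrite /=.
- by move=> i; rewrite /enc; case: pickle_inv => [t|]; rewrite ?mul0r// mulr_ge0// dist_ge0.
- move=> i /=; rewrite /enc; case: pickle_inv => [t|]; rewrite /= ?normr0 ?mul0r//.
  rewrite /= normrM ger0_norm ?dist_ge0// ler_wpM2l ?dist_ge0//.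
  by rewrite (ger0_norm (K0 t)).
- have -> : series (fun i => enc p i * `|K|) = series (enc p) \* (fun=> `|K|).
    by apply/funext => n; rewrite /series /= mulr_suml.
  apply: is_cvgM; last exact: is_cvg_cst.
  by apply/cvg_ex; exists 1; exact: dist_series.
Qed.

Lemma ExD p f g : dist p -> bnd f -> bnd g ->
  Ex p (fun t => f t + g t) = Ex p f + Ex p g.
Proof.
move=> dp bf bg; rewrite /Ex -limD; [|exact: Ex_cvg|exact: Ex_cvg].
congr (limn _); apply/funext => n; rewrite [RHS]/GRing.add/= /series/= -big_split/=.
apply: eq_bigr => i _; rewrite /enc; case: pickle_inv => [t|]; last by rewrite addr0.
by rewrite mulrDr.
Qed.

Lemma ExZ p f c : dist p -> bnd f -> Ex p (fun t => c * f t) = c * Ex p f.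
Proof.
move=> dp bf; have h := @Ex_cvg p f dp bf.
apply: cvg_lim => //; have e := cvgM (cvg_cst c) h.
suff -> : series (enc (fun t => p t * (c * f t))) =
    (fun=> c) \* series (enc (fun t => p t * f t)) by exact: e.
apply/funext => n; rewrite /series /= mulr_sumr.
apply: eq_bigr => i _; rewrite /enc; case: pickle_inv => [t|]; last by rewrite mulr0.
by ring.
Qed.

Lemma bndD f g : bnd f -> bnd g -> bnd (fun t => f t + g t).
Proof.
move=> [K fK] [L gL]; exists (K + L) => t.
by rewrite (le_trans (ler_normD _ _))// lerD.
Qed.

Lemma bndZ f c : bnd f -> bnd (fun t => c * f t).
Proof.
by move=> [K fK]; exists (`|c| * K) => t; rewrite normrM ler_wpM2l.
Qed.

Lemma bndB f g : bnd f -> bnd g -> bnd (fun t => f t - g t).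
Proof.
move=> bf bg.
have -> : (fun t => f t - g t) = (fun t => f t + (-1) * g t).
  by apply/funext => t; rewrite mulN1r.
exact/bndD/bndZ.
Qed.

Lemma bnd01 f : (forall t, 0 <= f t <= 1) -> bnd f.
Proof. by move=> f01; exists 1 => t; have := f01 t; rewrite ler_norml; lra. Qed.

Lemma bnd_cst c : bnd (fun=> c).
Proof. by exists `|c|. Qed.

Lemma ExB p f g : dist p -> bnd f -> bnd g ->
  Ex p (fun t => f t - g t) = Ex p f - Ex p g.
Proof.
move=> dp bf bg.
have -> : (fun t => f t - g t) = (fun t => f t + (-1) * g t).
  by apply/funext => t; rewrite mulN1r.
by rewrite ExD// ?ExZ ?mulN1r//; exact: bndZ.
Qed.

Lemma Ex_cst p c : dist p -> Ex p (fun=> c) = c.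
Proof.
move=> dp; have -> : Ex p (fun=> c) = c * Ex p (fun=> 1).
  rewrite -ExZ//; last exact: bnd_cst.
  by congr Ex; apply/funext => ?; rewrite mulr1.
rewrite [Ex _ _](_ : _ = 1) ?mulr1// /Ex.
apply: cvg_lim => //.
rewrite (_ : enc (fun t => p t * 1) = enc p); first exact: dist_series.
by apply/funext => i; rewrite /enc; case: pickle_inv => [t|//]; rewrite mulr1.
Qed.

Lemma Ex_le p f g : dist p -> bnd f -> bnd g ->
  (forall t, 0 < p t -> f t <= g t) -> Ex p f <= Ex p g.
Proof.
move=> dp bf bg fg; apply: lim_series_le; [exact: Ex_cvg|exact: Ex_cvg|].
move=> i; rewrite /enc; case: pickle_inv => [t|//].
have [p0|p0] := ltrP 0 (p t); first by rewrite ler_wpM2l ?fg// ltW.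
suff -> : p t = 0 by rewrite !mul0r.
by apply/eqP; rewrite eq_le p0 dist_ge0.
Qed.

Lemma Ex_le_cst p f c : dist p -> bnd f ->
  (forall t, 0 < p t -> f t <= c) -> Ex p f <= c.
Proof.
move=> dp bf fc; rewrite -[leRHS](Ex_cst c dp).
by apply: Ex_le => //; exact: bnd_cst.
Qed.

Lemma Ex_ge_cst p f c : dist p -> bnd f ->
  (forall t, 0 < p t -> c <= f t) -> c <= Ex p f.
Proof.
move=> dp bf fc; rewrite -[leLHS](Ex_cst c dp).
by apply: Ex_le => //; exact: bnd_cst.
Qed.

Lemma Ex_01 p f : dist p -> (forall t, 0 <= f t <= 1) -> 0 <= Ex p f <= 1.
Proof.
move=> dp f01; rewrite Ex_ge_cst ?Ex_le_cst//; try exact: bnd01.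
  by move=> t _; have /andP[] := f01 t.
by move=> t _; have /andP[] := f01 t.
Qed.

Lemma Ex_series_le p f n : dist p -> bnd f -> (forall t, 0 < p t -> 0 <= f t) ->
  series (enc (fun t => p t * f t)) n <= Ex p f.
Proof.
move=> dp bf f0; apply: nondecreasing_cvgn_le; last exact: Ex_cvg.
apply/nondecreasing_seqP => m; rewrite /series /= big_nat_recr//= lerDl.
rewrite /enc; case: pickle_inv => [t|//].
have := dist_ge0 t dp; rewrite le_eqVlt => /orP[/eqP<-|pt]; first by rewrite mul0r.
by rewrite mulr_ge0 ?f0// ltW.
Qed.

Lemma Ex_term p f t : dist p -> bnd f -> (forall t, 0 < p t -> 0 <= f t) ->
  p t * f t <= Ex p f.
Proof.
move=> dp bf f0; apply: le_trans (Ex_series_le (pickle t).+1 dp bf f0).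
rewrite /series /= big_nat_recr//= enc_pickle lerDr sumr_ge0// => i _.
rewrite /enc; case: pickle_inv => [u|//].
have := dist_ge0 u dp; rewrite le_eqVlt => /orP[/eqP<-|pt]; first by rewrite mul0r.
by rewrite mulr_ge0 ?f0// ltW.
Qed.

(** The nonnegative difference [g - f] has nonpositive expectation, so none of its terms can be
    positive. *)
Lemma Ex_eq_supp p f g t : dist p -> bnd f -> bnd g ->
  (forall t, 0 < p t -> f t <= g t) -> Ex p g <= Ex p f -> 0 < p t -> f t = g t.
Proof.
move=> dp bf bg fg gf pt; apply/eqP; rewrite eq_le fg//=.
have := @Ex_term p (fun t => g t - f t) t dp (bndB bg bf).
rewrite ExB// => /(_ _)/le_trans => h.
have : p t * (g t - f t) <= 0.
  by apply: h; [move=> u /fg; rewrite subr_ge0|rewrite subr_le0].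
by rewrite pmulr_rle0// subr_le0.
Qed.

(** Partial sums involve finitely many states, so they pass to the pointwise limit, and
    nonnegativity bounds them by [c]. *)
Lemma Ex_fatou p (F : nat -> S -> R) f c : dist p -> bnd f ->
  (forall n t, 0 <= F n t <= 1) -> (forall t, F ^~ t @ \oo --> f t) ->
  (forall n, Ex p (F n) <= c) -> Ex p f <= c.
Proof.
move=> dp bf F01 Ff Fc; apply: limr_le; first exact: Ex_cvg.
apply: nearW => N.
have h : (fun n => series (enc (fun t => p t * F n t)) N) @ \oo
    --> series (enc (fun t => p t * f t)) N.
  rewrite /series /=; apply: cvg_big => [|i _].
    exact: add_continuous.
  rewrite /enc; case: pickle_inv => [t|]; last exact: cvg_cst.
  by apply: cvgM; [exact: cvg_cst|exact: Ff].
rewrite -(cvg_lim (@Rhausdorff R) h); apply: limr_le.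
  by apply/cvg_ex; eexists; exact: h.
apply: nearW => n; apply: le_trans (Fc n); apply: Ex_series_le => //.
  exact: bnd01.
by move=> t _; have /andP[] := F01 n t.
Qed.

Definition dirac_at (s : S) : S -> R := fun t => (t == s)%:R.

Lemma dirac_at_distr (A : set S) s : A s -> is_distr A (dirac_at s).
Proof.
move=> As; split.
- by move=> t; rewrite /dirac_at ler0n.
- by move=> t; rewrite /dirac_at; case: (t =P s) => [->//|_]; rewrite eqxx.
- rewrite (esumID [set s])//; last by move=> t _; rewrite lee_fin ler0n.
  rewrite setTI esum_set1 ?lee_fin ?ler0n// [X in (_ + X)%E]esum1 ?adde0//.
    by rewrite /dirac_at eqxx.
  by move=> t [_ /= ts]; rewrite /dirac_at; case: eqP.
Qed.

Lemma dirac_at_dist s : dist (dirac_at s).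
Proof. exact: dirac_at_distr. Qed.

Lemma dirac_at_gt0 s t : 0 < dirac_at s t -> t = s.
Proof. by rewrite /dirac_at; case: eqP => // _; rewrite ltxx. Qed.

Lemma Ex_dirac s f : bnd f -> Ex (dirac_at s) f = f s.
Proof.
move=> bf; have ds := dirac_at_dist s; apply/eqP; rewrite eq_le.
by rewrite Ex_le_cst ?Ex_ge_cst// => t /dirac_at_gt0 ->.
Qed.

Lemma bnd_dirac s : bnd (dirac_at s).
Proof. by apply: bnd01 => t; rewrite /dirac_at; case: eqP; rewrite ?lexx ?ler01. Qed.

Lemma Ex_term1 p s : dist p -> Ex p (dirac_at s) = p s.
Proof.
move=> dp; apply/eqP; rewrite eq_le; apply/andP; split; last first.
  have := @Ex_term p (dirac_at s) s dp (bnd_dirac s).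
  by rewrite /dirac_at eqxx mulr1; apply=> t _; rewrite ler0n.
apply: limr_le; first exact/Ex_cvg/bnd_dirac.
apply: nearW => n; suff -> : series (enc (fun t => p t * dirac_at s t)) n =
    if (pickle s < n)%N then p s else 0 by case: ifP => // _; exact: dist_ge0.
elim: n => [|n IH]; first by rewrite /series /= big_nil.
have -> : forall u : nat -> R, series u n.+1 = series u n + u n.
  by move=> u; rewrite /series /= big_nat_recr.
have [sn|sn] := eqVneq n (pickle s).
  rewrite IH sn enc_pickle /dirac_at eqxx mulr1 ltnS leqnn.
  by rewrite ltnn add0r.
have -> : enc (fun t => p t * dirac_at s t) n = 0.
  rewrite /enc; have := @pickle_invK S n; case: pickle_inv => [t /= tn|//].
  rewrite /dirac_at; case: (t =P s) => [ts|]; last by rewrite mulr0.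
  by move: sn; rewrite -tn ts eqxx.
rewrite IH addr0 ltnS [in RHS]leq_eqVlt; case: (pickle s =P n) => [e|//].
by rewrite e eqxx in sn.
Qed.

Lemma Ex_reweight p h f :
  Ex (fun t => p t * h t) f = Ex p (fun t => h t * f t).
Proof.
rewrite /Ex (_ : (fun t => p t * h t * f t) = fun t => p t * (h t * f t))//.
by apply/funext => t; rewrite mulrA.
Qed.

Lemma dist_reweight p h : dist p -> bnd h -> (forall t, 0 <= h t) -> Ex p h = 1 ->
  dist (fun t => p t * h t).
Proof.
move=> dp bh h0 ph; have ph0 t : 0 <= p t * h t by rewrite mulr_ge0 ?(dist_ge0 _ dp).
split=> //; rewrite -[in RHS]ph /Ex -EFin_lim; last exact: Ex_cvg.
by apply/esym; apply: cvg_lim => //; exact: cvg_series_enc.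
Qed.

End expectation.

(** * Reachability *)

Section reachability.
Variables (R : realType) (S : countType).
Implicit Types (p f g w : S -> R) (A B : S -> set (S -> R)) (T : set S).

(* [A s] is the set of the distributions that may be chosen at [s]. *)
Definition house A := forall s, A s !=set0 /\ A s `<=` @dist R S.

Definition superharmonic c A T f :=
  [/\ forall t, 0 <= f t <= 1, forall t, T t -> f t = 1 &
      forall s, ~ T s -> forall p, A s p -> c * Ex p f <= f s].

(* The least discounted superharmonic function is the value of reaching [T]
   with discount [c]. *)
Definition dreach c A T s : R := inf [set f s | f in superharmonic c A T].

Definition reach A T s : R := dreach 1 A T s.

Section dreach.
Variables (c : R) (A : S -> set (S -> R)) (T : set S).
Hypotheses (c01 : 0 <= c <= 1) (hA : house A).

Lemma house_distr s p : A s p -> dist p.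
Proof. exact: (hA s).2. Qed.

Lemma superharmonic1 : superharmonic c A T (fun=> 1).
Proof.
split=> // [t|s _ p /house_distr dp]; first by rewrite ler01 lexx.
by rewrite Ex_cst// mulr1; case/andP: c01.
Qed.

Lemma dreach_le f s : superharmonic c A T f -> dreach c A T s <= f s.
Proof.
move=> sf; apply: ge_inf; last by exists f.
by exists 0 => _ [g [g01 _ _] <-]; case/andP: (g01 s).
Qed.

Lemma dreach_ge x s : (forall f, superharmonic c A T f -> x <= f s) ->
  x <= dreach c A T s.
Proof.
move=> xf; apply: lb_le_inf; first by exists 1, (fun=> 1) => //; exact: superharmonic1.
by move=> _ [f sf <-]; exact: xf.
Qed.

Lemma dreach01 s : 0 <= dreach c A T s <= 1.
Proof.
rewrite dreach_ge ?(dreach_le _ superharmonic1)// => f [f01 _ _].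
by case/andP: (f01 s).
Qed.

Lemma dreachT s : T s -> dreach c A T s = 1.
Proof.
move=> Ts; apply/eqP; rewrite eq_le; case/andP: (dreach01 s) => _ ->/=.
by apply: dreach_ge => f [_ /(_ _ Ts) -> _].
Qed.

Lemma dreach_super : superharmonic c A T (dreach c A T).
Proof.
split; [exact: dreach01|exact: dreachT|].
move=> s Ts p Ap; apply: dreach_ge => f sf; have dp := house_distr Ap.
have [f01 _ fs] := sf; apply: le_trans (fs s Ts p Ap).
case/andP: c01 => c0 _; apply: ler_wpM2l => //.
apply: Ex_le => //; [exact/bnd01/dreach01|exact/bnd01|].
by move=> t _; exact: dreach_le.
Qed.

(* Otherwise the value at [s] could be lowered. *)
Lemma dreach_greedy d s : c < d -> ~ T s ->
  exists2 p, A s p & dreach c A T s <= d * Ex p (dreach c A T).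
Proof.
move=> cd Ts; set w := dreach c A T.
have bw : bnd w by exact/bnd01/dreach01.
case/andP: c01 => c0 c1.
have d0 : 0 < d by exact: le_lt_trans cd.
apply: contrapT => /forall2NP nw.
have {}nw p : A s p -> d * Ex p w < w s.
  by move=> Ap; rewrite ltNge; apply/negP => h; case: (nw p).
have ws : w s <= c / d * w s.
  pose f t := if t == s then c / d * w s else w t.
  have fw t : f t <= w t.
    rewrite /f; case: eqP => // ->; rewrite ler_piMl//.
      by case/andP: (dreach01 s).
    by rewrite ler_pdivrMr// mul1r ltW.
  have f01 t : 0 <= f t <= 1.
    have /andP[w0 w1] := dreach01 t; rewrite (le_trans (fw t) w1) andbT.
    rewrite /f; case: eqP => // _; rewrite mulr_ge0// ?divr_ge0// ?(ltW d0)//.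
    by case/andP: (dreach01 s).
  have sf : superharmonic c A T f.
    split=> // [t Tt|t Tt p Ap].
      by rewrite /f; case: eqP Tt => [->//|_]; exact: dreachT.
    have dp := house_distr Ap.
    have le_w : c * Ex p f <= c * Ex p w.
      by rewrite ler_wpM2l//; apply: Ex_le => // ; exact: bnd01.
    rewrite /f; case: eqP Ap => [->|_] Ap; last first.
      by apply: le_trans le_w _; have [_ _] := dreach_super; exact.
    apply: (le_trans le_w); rewrite -mulrA ler_wpM2l//.
    by rewrite [leRHS]mulrC ler_pdivlMr// mulrC ltW// nw.
  by have := dreach_le s sf; rewrite /f eqxx.
have [[p Ap] _] := hA s; have := nw _ Ap.
have /andP[+ _] := Ex_01 (house_distr Ap) dreach01; rewrite -/w => e0.
suff : w s <= 0.
  by move=> w0 h; have := mulr_ge0 (ltW d0) e0; lra.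
have cd1 : c / d < 1 by rewrite ltr_pdivrMr// mul1r.
nra.
Qed.

End dreach.

Let one01 : 0 <= (1 : R) <= 1. Proof. by rewrite ler01 lexx. Qed.

Section reach.
Variables (A : S -> set (S -> R)).
Hypothesis hA : house A.

Lemma reach_le T f s : superharmonic 1 A T f -> reach A T s <= f s.
Proof. exact: dreach_le. Qed.

Lemma reach01 T s : 0 <= reach A T s <= 1.
Proof. exact: dreach01. Qed.

Lemma bnd_reach T : bnd (reach A T).
Proof. exact/bnd01/reach01. Qed.

Lemma reachT T s : T s -> reach A T s = 1.
Proof. exact: dreachT. Qed.

Lemma reach_step T s p : ~ T s -> A s p -> Ex p (reach A T) <= reach A T s.
Proof.
move=> Ts Ap; have [_ _ /(_ s Ts p Ap)] := dreach_super T one01 hA.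
by rewrite mul1r.
Qed.

Lemma reach_leS T T' s : T `<=` T' -> reach A T s <= reach A T' s.
Proof.
move=> TT'; apply: dreach_ge => // f [f01 fT fs]; apply: dreach_le; split=> //.
  by move=> t /TT'; exact: fT.
move=> u Tu p Ap; have [/fT ->|T'u] := pselect (T' u); last exact: fs.
by rewrite mul1r; case/andP: (Ex_01 (house_distr hA Ap) f01).
Qed.

(** The affine map sending [x] to 0 and 1 to 1 turns the reach value into a superharmonic
    competitor, smaller wherever the value is below 1; minimality forbids this. *)
Lemma reach_zero_one T x : 0 < x -> (forall s, x <= reach A T s) ->
  forall s, reach A T s = 1.
Proof.
move=> x0 xr s; apply/eqP; rewrite eq_le.
have /andP[_ r1] := reach01 T s; rewrite r1/=.
have [x1|x1] := leP 1 x; first by rewrite (le_trans x1).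
have bR := bnd_reach T.
pose f t := (1 - x)^-1 * (reach A T t - x).
have x1' : 0 < 1 - x by rewrite subr_gt0.
have : reach A T s <= f s.
  apply: reach_le; split.
  - move=> t; rewrite /f; have := xr t; have /andP[_] := reach01 T t => h1 h2.
    by rewrite mulr_ge0 ?invr_ge0 ?subr_ge0 ?(ltW x1)//= mulrC ler_pdivrMr//; lra.
  - by move=> t Tt; rewrite /f reachT// mulVf// gt_eqF.
  - move=> t Tt p Ap; rewrite mul1r /f.
    have dp := house_distr hA Ap.
    rewrite ExZ//; last by apply: bndB => //; exact: bnd_cst.
    rewrite ler_wpM2l ?invr_ge0 ?(ltW x1')// ExB//; last exact: bnd_cst.
    by rewrite Ex_cst// lerB// reach_step.
rewrite /f mulrC ler_pdivlMr//; nra.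
Qed.

(** The strict discount replaces a limit along the play: a positive supremum of [g - reach A T]
    would be at most [c] times itself. Nothing is asked of [b] where [g] is 0, so [g] may be a
    positive part supported where actions are imposed. *)
Lemma reach_ge_sub T g b c : 0 <= c < 1 -> (forall s, 0 <= g s <= 1) ->
  (forall s, ~ T s -> 0 < g s -> A s (b s) /\ g s <= c * Ex (b s) g) ->
  forall s, g s <= reach A T s.
Proof.
move=> /andP[c0 c1] g01 gs; pose D := [set g s - reach A T s | s in [set: S]].
move=> s0; have ubD : has_ubound D.
  exists 1 => _ [s _ <-]; have := g01 s; have := reach01 T s; lra.
have gD s : g s - reach A T s <= sup D by apply: ub_le_sup => //; exists s.
suff : sup D <= 0 by move=> h; have := gD s0; lra.
rewrite leNgt; apply/negP => D0.
have bg : bnd g by exact: bnd01.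
have bR := bnd_reach T.
suff : sup D <= c * sup D by nra.
apply: ge_sup; first by exists (g s0 - reach A T s0), s0.
move=> _ [s _ <-].
have cD : 0 <= c * sup D by rewrite mulr_ge0// ltW.
have /andP[r0 r1] := reach01 T s; have /andP[g0 g1] := g01 s.
have [Ts|Ts] := pselect (T s); first by rewrite reachT//; lra.
have [g00|g00] := leP (g s) 0; first by lra.
have [Ab gb] := gs s Ts g00; have db := house_distr hA Ab.
have := reach_step Ts Ab.
have : Ex (b s) (fun t => g t - reach A T t) <= sup D.
  by apply: Ex_le_cst => //; exact: bndB.
rewrite ExB// => h1 h2.
have /andP[e0 e1] := Ex_01 db (reach01 T).
nra.
Qed.

(** The values for discounts increasing to 1 have a limit that is superharmonic by Fatou, hence at
    least the reach value; so some discounted value already exceeds [x] on average under [p], and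
    its greedy actions form [b]. *)
Lemma reach_discount T p x : dist p -> x < Ex p (reach A T) ->
  exists (c : R) w b, [/\ 0 <= c < 1, forall t, 0 <= w t <= 1,
    forall t, T t -> w t = 1, x < Ex p w & forall s, A s (b s) /\
    (~ T s -> w s <= c * Ex (b s) w)].
Proof.
move=> dp xR; pose c (n : nat) : R := 1 - harmonic n.
have c0 n : 0 <= c n by rewrite /c /harmonic/= subr_ge0 invf_le1 ?ltr0n// ler1n.
have c1 n : c n < 1 by rewrite /c ltrBlDr ltrDl invr_gt0 ltr0n.
have c01 n : 0 <= c n <= 1 by rewrite c0 ltW.
have cS : {homo c : m n / (m <= n)%N >-> m <= n}.
  by move=> m n mn; rewrite /c lerB// lef_pV2 ?posrE ?ltr0n// ler_nat ltnS.
have cc : c @ \oo --> (1 : R).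
  rewrite -[X in _ --> X]subr0; apply: cvgB; first exact: cvg_cst.
  exact: cvg_harmonic.
pose w n := dreach (c n) A T.
have w01 n s : 0 <= w n s <= 1 by exact: dreach01.
have wS s : {homo w ^~ s : m n / (m <= n)%N >-> m <= n}.
  move=> m n mn; apply: dreach_ge => // f [f01 fT fs]; apply: dreach_le; split=> //.
  move=> u Tu q Aq; apply: le_trans (fs u Tu q Aq).
  rewrite ler_wpM2r ?cS//.
  by case/andP: (Ex_01 (house_distr hA Aq) f01).
have wc s : cvgn (w ^~ s).
  apply: nondecreasing_is_cvgn; first exact: wS.
  by exists 1 => _ [n _ <-]; case/andP: (w01 n s).
pose W s := limn (w ^~ s).
have wW n s : w n s <= W s by exact: (nondecreasing_cvgn_le (wS s) (wc s)).
have W01 s : 0 <= W s <= 1.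
  apply/andP; split; first by apply: le_trans (wW 0%N s); case/andP: (w01 0%N s).
  by apply: limr_le; [exact: wc|apply: nearW => n; case/andP: (w01 n s)].
have sW : superharmonic 1 A T W.
  split=> // [t Tt|s Ts q Aq].
    apply/eqP; rewrite eq_le; case/andP: (W01 t) => _ ->/=.
    by rewrite (le_trans _ (wW 0%N t))// /w dreachT.
  have dq := house_distr hA Aq.
  rewrite mul1r; apply: (@Ex_fatou _ _ q (fun n t => c n * w n t)) => //.
  - exact: bnd01.
  - move=> n t; have /andP[w0 w1] := w01 n t; rewrite mulr_ge0//=.
    by rewrite mulr_ile1// ltW.
  - by move=> t; rewrite -[X in _ --> X]mul1r; apply: cvgM => //; exact: wc.
  - move=> n; rewrite ExZ//; last exact: bnd01.
    apply: le_trans (wW n s); have [_ _] := dreach_super T (c01 n) hA.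
    exact.
have [n xn] : exists n, x < Ex p (w n).
  apply: contrapT => /forallNP nx; move: xR; apply/negP; rewrite -leNgt.
  have bR := bnd_reach T.
  apply: (@le_trans _ _ (Ex p W)).
    by apply: Ex_le => // [|t _]; [exact: bnd01|exact: reach_le].
  apply: (Ex_fatou dp (bnd01 W01) w01 wc) => n.
  by rewrite leNgt; apply/negP/nx.
(* Any [d] strictly between [c n] and 1 leaves the room that [dreach_greedy] needs. *)
pose d := (1 + c n) / 2; have cn1 := c1 n.
have cd : c n < d by rewrite /d; lra.
have /choice[b bP] : forall s, exists q, A s q /\ (~ T s -> w n s <= d * Ex q (w n)).
  move=> s; have [Ts|Ts] := pselect (T s).
    by have [[q Aq] _] := hA s; exists q; split.
  by have [q Aq h] := dreach_greedy (c01 n) hA cd Ts; exists q; split.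
exists d, (w n), b; split=> //.
- by have := c0 n; rewrite /d; lra.
- by move=> t Tt; exact: dreachT.
Qed.

Definition fix_house b (h : S -> R) : S -> set (S -> R) :=
  fun s => if 1 / 2 < h s then [set b s] else A s.

Lemma fix_sub b h : (forall s, A s (b s)) -> forall s, fix_house b h s `<=` A s.
Proof. by move=> Ab s p; rewrite /fix_house; case: ifP => // _ ->. Qed.

Lemma fix_mem b h : (forall s, A s (b s)) -> forall s, fix_house b h s (b s).
Proof. by move=> Ab s; rewrite /fix_house; case: ifP. Qed.

End reach.

Lemma house_sub A B : house A -> (forall s, B s !=set0) ->
  (forall s, B s `<=` A s) -> house B.
Proof.
by move=> hA B0 BA s; split=> // p /BA; exact: house_distr.
Qed.

Lemma house_fix A b h : house A -> (forall s, A s (b s)) -> house (fix_house A b h).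
Proof.
move=> hA Ab; apply: (house_sub hA); last exact: fix_sub.
by move=> s; exists (b s); exact: fix_mem.
Qed.

(** Let [r] be the reach value in the restricted house. Then [min 1 (2 * r)] is superharmonic in [A]
    for the enlarged target: it is 1 where [b] is imposed, because [h <= r], and elsewhere the
    houses agree. So [r] is at least 1/2 everywhere, and the zero-one law applies. *)
Lemma reach_fix A b h T : house A -> (forall s, A s (b s)) ->
  (forall s, reach A (T `|` [set s | 1 / 2 < h s]) s = 1) ->
  (forall s, h s <= reach (fix_house A b h) T s) ->
  forall s, reach (fix_house A b h) T s = 1.
Proof.
move=> hA Ab r1 hr; have hB := house_fix h hA Ab; set B := fix_house A b h.
have /reach_zero_one : 0 < (1 / 2 : R) by lra.
apply=> // s; set r := reach B T.
pose f t := Num.min 1 (2 * r t).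
have r01 t : 0 <= r t <= 1 by exact: reach01.
suff : reach A (T `|` [set s | 1 / 2 < h s]) s <= f s.
  by rewrite r1 /f le_min; lra.
have f01 t : 0 <= f t <= 1.
  by have := r01 t; rewrite /f le_min ge_min; lra.
apply: reach_le; split=> // [t Tt|t Tt p Ap].
  apply/eqP; rewrite eq_le; case/andP: (f01 t) => _ ->/=.
  rewrite /f le_min lexx/=; case: Tt => [Tt|/= ht].
    by rewrite /r reachT// mulr1; lra.
  by have := hr t; rewrite -/B -/r; lra.
have dp := house_distr hA Ap.
rewrite mul1r /f le_min; apply/andP; split.
  by case/andP: (Ex_01 dp f01).
have br : bnd r by exact: bnd01.
apply: (@le_trans _ _ (Ex p (fun t => 2 * r t))).
  apply: Ex_le => // [||u _]; [exact: bnd01|exact: bndZ|].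
  by rewrite /f ge_min lexx orbT.
rewrite ExZ// ler_wpM2l//; apply: reach_step => //; first by move=> ?; apply: Tt; left.
by rewrite /B /fix_house; case: ifP => // ht; case: Tt; right.
Qed.

(* A step of Ornstein's plastering: imposing a discounted policy where it
   reaches [T] with probability above 1/2 keeps the reach values above 1/2,
   hence equal to 1. *)
Lemma reach_plaster A T s0 : house A -> (forall s, reach A T s = 1) ->
  exists B g (c : R), [/\ house B, forall s, B s `<=` A s,
    forall s, reach B T s = 1, 1 / 2 <= g s0 &
    [/\ 0 <= c < 1, forall s, 0 <= g s <= 1 &
    forall s, 0 < g s -> exists p, B s = [set p] /\ (~ T s -> g s <= c * Ex p g)]].
Proof.
move=> hA r1.
have xr : 3 / 4 < Ex (dirac_at R s0) (reach A T).
  by rewrite Ex_dirac ?r1; [lra|exact: bnd_reach].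
have [c [w [b [c01 w01 wT + bP]]]] := reach_discount hA (dirac_at_dist _ s0) xr.
have bw := bnd01 w01; rewrite Ex_dirac// => ws0.
have Ab s := (bP s).1; have wb s := (bP s).2.
pose h s := 2 * w s - 1.
(* This certificate is positive only where [b] is imposed. It inherits the discounted inequality
   because [c <= 1] gives [- 1 <= - c], and [w s0 > 3 / 4] makes it at least 1/2 at [s0]. *)
pose g s := Num.max 0 (2 * w s - 1).
have g01 s : 0 <= g s <= 1.
  by have := w01 s; rewrite /g le_max ge_max lexx/=; lra.
exists (fix_house A b w), g, c; split.
- exact: house_fix.
- exact: fix_sub.
- apply: reach_fix => //.
    move=> s; have TT' : T `<=` T `|` [set s | 1 / 2 < w s] by move=> t; left.
    have := reach_leS hA s TT'; rewrite r1.
    have := reach01 hA (T `|` [set s | 1 / 2 < w s]) s; lra.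
  apply: (@reach_ge_sub _ _ _ _ b c) => // [|s Ts ws]; first exact: house_fix.
  by split; [exact: fix_mem|exact: wb].
- by rewrite /g le_max; lra.
split=> // s gs; exists (b s); split.
  by rewrite /fix_house ifT//; move: gs; rewrite /g lt_max ltxx/=; lra.
move=> Ts; have db := house_distr hA (Ab s).
have := wb s Ts; have : 2 * Ex (b s) w - 1 <= Ex (b s) g.
  rewrite -ExZ// -[X in _ - X](Ex_cst 1 db) -ExB//; [|exact: bndZ|exact: bnd_cst].
  apply: Ex_le => // [||t _]; [|exact: bnd01|].
    by apply: bndB; [exact: bndZ|exact: bnd_cst].
  by rewrite /g le_max lexx orbT.
move: gs; rewrite {1 2}/g lt_max ltxx/= => gs h1 h2.
rewrite ge_max; apply/andP; split; last by nra.
by case/andP: (Ex_01 db g01) => ? _; rewrite mulr_ge0//; case/andP: c01.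
Qed.

(** Reach values need not pass to the limit of decreasing houses, so certificates are carried along:
    stage [pickle s] leaves a discounted subsolution that is at least 1/2 at [s] and whose support
    has only singleton actions. Later stages cannot change these, so the certificate holds for the
    limit policy, and the zero-one law concludes. *)
Lemma reach_policy A T : house A -> (forall s, reach A T s = 1) ->
  exists2 a, (forall s, A s (a s)) &
    forall s, reach (fun s => [set a s]) T s = 1.
Proof.
move=> hA r1.
pose good := {B | house B /\ (forall s, reach B T s = 1)}.
pose next (n : nat) (B B' : good) := (forall s, sval B' s `<=` sval B s) /\
  forall s0, pickle s0 = n -> exists (g : S -> R) (c : R), 1 / 2 <= g s0 /\
  [/\ 0 <= c < 1, forall s, 0 <= g s <= 1 &
    forall s, 0 < g s -> exists p, sval B' s = [set p] /\ (~ T s -> g s <= c * Ex p g)].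
have /choice[F FP] : forall nB : nat * good, exists B' : good, next nB.1 nB.2 B'.
  move=> [n [B [hB rB]]] /=.
  have [[s0 s0n]|ns0] := pselect (exists s0 : S, pickle s0 = n); last first.
    exists (exist _ B (conj hB rB)); split=> [s p|s0 s0n]; first exact: id.
    by case: ns0; exists s0.
  have [B' [g [c [hB' B'B rB' gs0 gP]]]] := reach_plaster s0 hB rB.
  exists (exist _ B' (conj hB' rB')); split=> // s1.
  by rewrite -s0n => /(pcan_inj (@pickleK _)) ->; exists g, c.
pose H := fix H n : good :=
  if n is m.+1 then F (m, H m) else exist _ A (conj hA r1).
have HP n : next n (H n) (H n.+1) by exact: FP (n, H n).
have Hmono m n s : (m <= n)%N -> sval (H n) s `<=` sval (H m) s.
  elim: n => [|n IH]; first by rewrite leqn0 => /eqP ->.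
  rewrite leq_eqVlt => /predU1P[-> //|]; rewrite ltnS => /IH h p Hp.
  by apply: h; case: (HP n) => + _; apply.
have Hhouse n : house (sval (H n)) by case: (svalP (H n)).
have /choice[a aP] : forall s, exists p, sval (H (pickle s).+1) s p.
  by move=> s; have [[p Hp] _] := Hhouse (pickle s).+1 s; exists p.
(* Houses after stage [pickle s] are nonempty subsets of a singleton at [s], hence equal to it. *)
have aH s n : sval (H n) s (a s).
  have [le_n|lt_n] := leqP n (pickle s).+1; first exact: Hmono le_n _ _.
  have [_ /(_ s erefl)[g [c [gs [_ _]]]]] := HP (pickle s).
  move=> /(_ s)[]; first by lra.
  move=> p [Hp _]; have := aP s; rewrite Hp/= => ->.
  have [[q Hq] _] := Hhouse n s.
  by have := Hmono _ _ _ (ltnW lt_n) _ Hq; rewrite Hp => <-.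
exists a; first by move=> s; exact: aH s 0%N.
have ha : house (fun s => [set a s]).
  move=> s; split; first by exists (a s).
  by move=> _ ->; exact: (hA s).2 _ (aH s 0%N).
have /(reach_zero_one ha) : 0 < (1 / 2 : R) by lra.
apply=> s; have [_ /(_ s erefl)[g [c [gs [c01 g01 gP]]]]] := HP (pickle s).
apply: le_trans gs _; apply: (@reach_ge_sub _ ha T g a c) => // u Tu gu.
split=> //; have [p [Hp]] := gP u gu.
by have := aH u (pickle s).+1; rewrite Hp/= => -> /(_ Tu).
Qed.

End reachability.

(** * Safety *)

Section safety.
Variables (R : realType) (S : countType).
Implicit Types (p f g w : S -> R) (A B : S -> set (S -> R)) (T Z : set S).

Definition subsafe A Z f := [/\ forall t, 0 <= f t <= 1,
  forall t, ~ Z t -> f t = 0 &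
  forall s e, 0 < e -> exists2 p, A s p & f s <= Ex p f + e].

(* The value of staying in [Z] forever; with infinitely many actions the
   supremum in the fixed point equation need not be attained, whence [e]. *)
Definition safe A Z s : R := sup [set f s | f in subsafe A Z].

Section safe.
Variables (A : S -> set (S -> R)) (Z : set S).
Hypothesis hA : house A.

Lemma subsafe0 : subsafe A Z (fun=> 0).
Proof.
split=> // [t|s e e0]; first by rewrite lexx ler01.
have [[p Ap] _] := hA s; exists p => //.
by rewrite Ex_cst ?add0r ?ltW//; exact: house_distr Ap.
Qed.

Lemma le_safe f s : subsafe A Z f -> f s <= safe A Z s.
Proof.
move=> pf; apply: ub_le_sup; last by exists f.
by exists 1 => _ [g [g01 _ _] <-]; case/andP: (g01 s).
Qed.

Lemma safe_le x s : (forall f, subsafe A Z f -> f s <= x) -> safe A Z s <= x.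
Proof.
move=> fx; apply: ge_sup; first by exists 0, (fun=> 0) => //; exact: subsafe0.
by move=> _ [f pf <-]; exact: fx.
Qed.

Lemma safe01 s : 0 <= safe A Z s <= 1.
Proof.
rewrite (le_safe s subsafe0) safe_le// => f [f01 _ _].
by case/andP: (f01 s).
Qed.

Lemma safe_off s : ~ Z s -> safe A Z s = 0.
Proof.
move=> Zs; apply/eqP; rewrite eq_le (le_safe s subsafe0) andbT.
by apply: safe_le => f [_ /(_ _ Zs) -> _].
Qed.

Lemma safe_greedy s e : 0 < e -> exists2 p, A s p & safe A Z s <= Ex p (safe A Z) + e.
Proof.
move=> e0; have e20 : 0 < e / 2 by lra.
have [|_ [f pf <-] fs] := @sup_adherent _ [set f s | f in subsafe A Z] _ e20.
  split; first by exists 0, (fun=> 0) => //; exact: subsafe0.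
  by exists 1 => _ [g [g01 _ _] <-]; case/andP: (g01 s).
have [f01 _ /(_ s _ e20)[p Ap fp]] := pf.
exists p => //; have : Ex p f <= Ex p (safe A Z).
  apply: Ex_le; [exact: house_distr Ap|exact: bnd01|exact/bnd01/safe01|].
  by move=> t _; exact: le_safe.
by move: fs; rewrite -/(safe A Z s); lra.
Qed.

End safe.

(* [g] is a weighted sum of the reach values of the single states. *)
Lemma exists_leak A Z : house A ->
  (forall x, Z x -> exists2 k : R, k < 1 &
     forall p, A x p -> Ex p (reach A [set x]) <= k) ->
  exists g l : S -> R, [/\ forall s, 0 <= g s <= 1 / 8,
    forall s, 0 <= l s, forall s, Z s -> 0 < l s &
    forall s p, A s p -> Ex p g + l s <= g s].
Proof.
move=> hA hZ.
have /choice[k kP] : forall x, exists k : R, [/\ k <= 1, Z x -> k < 1 &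
    forall p, A x p -> Ex p (reach A [set x]) <= k].
  move=> x; have [/hZ[k k1 kP]|Zx] := pselect (Z x).
    by exists k; split=> //; exact: ltW.
  exists 1; split=> // p Ap.
  by have /andP[] := Ex_01 (house_distr hA Ap) (reach01 hA [set x]).
pose G n s : R := if pickle_inv n is Some x then reach A [set x] s else 0.
have G01 n s : 0 <= G n s <= 1.
  by rewrite /G; case: pickle_inv => [x|]; [exact: reach01|rewrite lexx ler01].
have bG n : bnd (G n) by exact: bnd01.
have GS n s p : A s p -> Ex p (G n) <= G n s.
  move=> Ap; have dp := house_distr hA Ap; rewrite /G.
  case: (pickle_inv n) => [x|]; last by rewrite Ex_cst.
  have [->|sx] := eqVneq s x; last by apply: reach_step => //; exact/eqP.
  by rewrite [leRHS]reachT//; have /andP[] := Ex_01 dp (reach01 hA [set x]).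
(* These weights sum to 1/8. *)
pose c (n : nat) : R := 16^-1 * 2^-1 ^+ n.
have c0 n : 0 < c n by rewrite mulr_gt0// exprn_gt0.
pose F N s := \sum_(i < N) c i * G i s.
have FS N s : F N.+1 s = F N s + c N * G N s by rewrite /F big_ord_recr.
have F0 N s : 0 <= F N s.
  by rewrite sumr_ge0// => i _; rewrite mulr_ge0 ?(ltW (c0 _))//; case/andP: (G01 i s).
have F1 N s : F N s <= 1 / 8 - 8^-1 * 2^-1 ^+ N.
  elim: N => [|N IH]; first by rewrite /F big_ord0 expr0; lra.
  rewrite FS exprS; have := G01 N s; have := c0 N; move: IH; rewrite /c.
  set y := 2^-1 ^+ N; nra.
have F8 N s : F N s <= 1 / 8.
  by apply: le_trans (F1 N s) _; rewrite gerBl mulr_ge0// exprn_ge0.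
have F01 N s : 0 <= F N s <= 1 by rewrite F0/= (le_trans (F8 N s))//; lra.
have Fmono s : {homo F ^~ s : m n / (m <= n)%N >-> m <= n}.
  apply/nondecreasing_seqP => n; rewrite FS lerDl mulr_ge0 ?(ltW (c0 _))//.
  by case/andP: (G01 n s).
have Fc s : cvgn (F ^~ s).
  apply: nondecreasing_is_cvgn; first exact: Fmono.
  by exists (1 / 8) => _ [n _ <-].
pose g s := limn (F ^~ s).
have Fg N s : F N s <= g s by exact: (nondecreasing_cvgn_le (Fmono s) (Fc s)).
have g8 s : 0 <= g s <= 1 / 8.
  rewrite (le_trans (F0 0%N s) (Fg _ _))/=.
  by apply: limr_le; [exact: Fc|exact: nearW].
(* At [s] the reach value of [s] itself drops from 1 to at most [k s] on average, and no other term
   grows; the weighted drop is the loss that can be paid there. *)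
pose l s := c (pickle s) * (1 - k s).
exists g, l; split=> // [s|s Zs|s p Ap].
- by rewrite mulr_ge0 ?(ltW (c0 _))// subr_ge0; case: (kP s).
- by rewrite mulr_gt0// subr_gt0; case: (kP s) => _ /(_ Zs).
have dp := house_distr hA Ap.
have EF N : Ex p (F N) <= F N s - (if (pickle s < N)%N then l s else 0).
  elim: N => [|N IH].
    rewrite /F big_ord0 ltn0 subr0 (_ : (fun s => _) = fun=> 0) ?Ex_cst//.
    by apply/funext => t; rewrite big_ord0.
  have -> : F N.+1 = fun t => F N t + c N * G N t by apply/funext => t.
  rewrite ExD//; [|exact: bnd01|exact: bndZ]; rewrite ExZ//=.
  have cG : c N * Ex p (G N) <= c N * G N s by rewrite ler_wpM2l ?(ltW (c0 _))// GS.
  rewrite ltnS leq_eqVlt; case: eqP => [sN|_] /=; last first.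
    by rewrite [leRHS]addrAC lerD.
  move: IH; rewrite -sN ltnn => IH; have [_ _ /(_ _ Ap)] := kP s.
  rewrite {cG}/l /G pickleK_inv reachT// => kE.
  have : c (pickle s) * Ex p (reach A [set s]) <= c (pickle s) * k s.
    by rewrite ler_wpM2l ?(ltW (c0 _)).
  move: IH; rewrite sN => IH h; apply: le_trans (lerD IH h) _; lra.
rewrite -lerBrDr.
(* Past the index of [s], every partial sum already accounts for the loss [l s]. *)
apply: (@Ex_fatou _ _ p (fun n => F (n + (pickle s).+1)%N)) => //.
- by apply: bnd01 => t; have := g8 t; lra.
- by move=> t; have := Fc t; rewrite -(cvg_shiftn (pickle s).+1).
- move=> n; apply: le_trans (EF _) _; rewrite ltn_addl//.
  by rewrite lerB.
Qed.

(** The return bound is asked on [Z] only, since the states outside [opt_state] will be absorbing in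
    the conditioned process. The function [g] certifies safety: being a submartingale under [a] that
    vanishes off [Z], it bounds from below the probability of staying in [Z] forever. *)
Lemma safety_reachability_policy A Z Y : house A ->
  (forall x, Z x -> exists2 k : R, k < 1 &
     forall p, A x p -> Ex p (reach A [set x]) <= k) ->
  (forall s, reach A (Y `|` [set t | 7 / 8 <= safe A Z t]) s = 1) ->
  exists a g, [/\ forall s, A s (a s), forall s, 0 <= g s <= 1,
    forall s, ~ Z s -> g s = 0, forall s, g s <= Ex (a s) g &
    forall s, reach (fun s => [set a s]) (Y `|` [set t | 1 / 2 <= g t]) s = 1].
Proof.
move=> hA hZ r1; have [g0 [l [g08 l0 lZ gl]]] := exists_leak hA hZ.
set u := safe A Z in r1 *.
have u01 s : 0 <= u s <= 1 by exact: safe01.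
have bu := bnd01 u01.
have bg0 : bnd g0 by apply: bnd01 => s; have := g08 s; lra.
have /choice[b bP] : forall s, exists p, A s p /\ u s <= Ex p u + l s.
  move=> s; have [Zs|Zs] := pselect (Z s).
    by have [p Ap up] := safe_greedy Z hA s (lZ s Zs); exists p.
  have [[p Ap] _] := hA s; exists p; split=> //.
  rewrite /u safe_off// addr_ge0 ?l0//.
  by case/andP: (Ex_01 (house_distr hA Ap) u01).
have Ab s := (bP s).1.
have db s : dist (b s) by exact: house_distr (Ab s).
(* The action [b s] loses at most [l s] of the safety value, and [g0] falls by at least as much on
   average, so the difference is a submartingale under [b]. *)
pose h s := u s - g0 s; pose h' s := Num.max 0 (h s).
have h'01 s : 0 <= h' s <= 1.
  by rewrite /h' /h; have := u01 s; have := g08 s; rewrite le_max ge_max lexx/=; lra.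
have bh' := bnd01 h'01.
have h'S s : h' s <= Ex (b s) h'.
  rewrite {1}/h' ge_max; apply/andP; split; first by case/andP: (Ex_01 (db s) h'01).
  have := gl s _ (Ab s); have := (bP s).2.
  have : Ex (b s) u - Ex (b s) g0 <= Ex (b s) h'.
    rewrite -ExB//; apply: Ex_le => // [|t _]; first exact: bndB.
    by rewrite /h' le_max lexx orbT.
  by rewrite /h; lra.
have h'Z s : ~ Z s -> h' s = 0.
  move=> Zs; have := safe_off hA Zs; rewrite -/(u s) /h' /h => ->.
  by apply: max_idPl; have := g08 s; lra.
have uh' s : 7 / 8 <= u s -> 3 / 4 <= h' s.
  by move=> us; rewrite /h' le_max /h; have := g08 s; lra.
clearbody h'.
pose T : set S := Y `|` [set t | 3 / 4 <= h' t].
pose A1 := fix_house A b h'.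
have hA1 : house A1 by exact: house_fix.
have uT s : ~ T s -> u s < 7 / 8.
  move=> Ts; rewrite ltNge; apply/negP => us; apply: Ts; right; exact: uh'.
have TT' : Y `|` [set t | 7 / 8 <= u t] `<=` T.
  by move=> s [Ys|/= us]; [left|right; exact: uh'].
have hr s : h' s <= reach A1 T s.
  (* Otherwise the positive part [f] of the difference, rescaled so that its
     supremum is 1, would be a competitor in the definition of [safe], which
     is at most 7/8 off [T]. *)
  set r := reach A1 T; have r01 t : 0 <= r t <= 1 by exact: reach01.
  have br := bnd01 r01.
  have rT t : T t -> r t = 1 by exact: reachT.
  have rS t : ~ T t -> Ex (b t) r <= r t.
    by move=> Tt; apply: reach_step => //; exact: fix_mem.
  clearbody r.
  pose f t := Num.max 0 (h' t - r t).
  have f01 t : 0 <= f t <= 1.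
    by have := h'01 t; have := r01 t; rewrite /f le_max ge_max lexx/=; lra.
  have bf := bnd01 f01.
  pose m := sup (range f).
  have ubf : has_ubound (range f) by exists 1 => _ [t _ <-]; case/andP: (f01 t).
  have fm t : f t <= m by apply: ub_le_sup => //; exists t.
  suff m0 : m <= 0.
    by have := fm s; rewrite /f ge_max; lra.
  rewrite leNgt; apply/negP => m0.
  have fS t : f t <= Ex (b t) f.
    have Ef0 : 0 <= Ex (b t) f by case/andP: (Ex_01 (db t) f01).
    have [Tt|Tt] := pselect (T t).
      rewrite {1}/f rT// ge_max Ef0/=.
      by apply: le_trans Ef0; rewrite subr_le0; case/andP: (h'01 t).
    rewrite {1}/f ge_max Ef0/=.
    have := rS t Tt; have := h'S t; have : Ex (b t) h' - Ex (b t) r <= Ex (b t) f.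
      rewrite -ExB//; apply: Ex_le => // [|v _]; first exact: bndB.
      by rewrite /f le_max lexx orbT.
    lra.
  have pf : subsafe A Z (fun t => m^-1 * f t).
    split.
    - move=> t; have /andP[f0 _] := f01 t.
      by rewrite mulr_ge0 ?invr_ge0 ?(ltW m0)//= mulrC ler_pdivrMr// mul1r fm.
    - move=> t Zt; rewrite /f h'Z// (_ : Num.max _ _ = 0) ?mulr0//.
      by apply: max_idPl; have := r01 t; lra.
    - move=> t e e0; exists (b t) => //; rewrite ExZ//.
      by apply: ler_wpDr; [exact: ltW|rewrite ler_wpM2l ?invr_ge0 ?(ltW m0)].
  suff : m <= 7 / 8 * m by nra.
  apply: ge_sup; first by exists (f s), s.
  move=> _ [t _ <-]; have [Tt|Tt] := pselect (T t).
    by rewrite /f rT// ge_max; have := h'01 t; nra.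
  have := le_safe t pf; rewrite -/(u t) => /le_lt_trans/(_ (uT t Tt)).
  by rewrite mulrC ltr_pdivrMr//; exact: ltW.
have r11 s : reach A1 T s = 1.
  apply: reach_fix => // t; apply/eqP; rewrite eq_le.
  case/andP: (reach01 hA (T `|` [set s | 1 / 2 < h' s]) t) => _ -> /=.
  by rewrite -(r1 t); apply: reach_leS => // v /TT'; left.
have [a A1a ra] := reach_policy hA1 r11.
(* Positive only where [a] is forced to agree with [b]; the threshold 3/4 for [h'] becomes 1/2. *)
pose g s := Num.max 0 (2 * h' s - 1).
have g01 s : 0 <= g s <= 1.
  by have := h'01 s; rewrite /g le_max ge_max lexx/=; lra.
exists a, g; split=> //.
- by move=> s; apply: fix_sub (A1a s).
- move=> s Zs; rewrite /g h'Z//; apply: max_idPl; lra.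
- move=> s; have das : dist (a s) by exact: house_distr (A1a s).
  rewrite {1}/g ge_max; apply/andP; split; first by case/andP: (Ex_01 das g01).
  have [hs|hs] := ltP (1 / 2) (h' s); last first.
    by apply: (@le_trans _ _ 0); [lra|case/andP: (Ex_01 das g01)].
  have ab : a s = b s by have := A1a s; rewrite /A1 /fix_house hs.
  have : 2 * Ex (a s) h' - 1 <= Ex (a s) g.
    rewrite -ExZ// -[X in _ - X](Ex_cst 1 das) -ExB//; [|exact: bndZ|exact: bnd_cst].
    apply: Ex_le => // [||t _]; [|exact: bnd01|].
      by apply: bndB; [exact: bndZ|exact: bnd_cst].
    by rewrite /g le_max lexx orbT.
  by have := h'S s; rewrite -ab; lra.
- have <- : T = Y `|` [set t | 1 / 2 <= g t].
    congr (_ `|` _); apply/seteqP; split=> t /=; rewrite /g le_max.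
      by move=> ?; apply/orP; right; lra.
    by case/orP; lra.
  exact: ra.
Qed.

End safety.

(** * The path measure *)

Definition scons (S : countType) (s : S) (r : nat -> S) : nat -> S :=
  fun n => if n is m.+1 then r m else s.

(** The measurable sets of every [path_space s], freed from the index [s] so that one event can be
    used with all starting states. *)
Definition mevent (S : countType) : set (set (nat -> S)) :=
  <<s range (@cylinder S) >>.

Section events.
Variable S : countType.
Implicit Types (E : set (nat -> S)) (r : nat -> S).

Lemma meventE E (s : S) : mevent E = measurable (E : set (path_space s)).
Proof. by []. Qed.

Lemma mevent_cylinder w : mevent (@cylinder S w).
Proof. by apply: sub_sigma_algebra; exists w. Qed.

Lemma mevent0 : mevent (set0 : set (nat -> S)).
Proof. by have [] := @smallest_sigma_algebra _ setT (range (@cylinder S)). Qed.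

Lemma meventC E : mevent E -> mevent (~` E).
Proof.
have [_ + _] := @smallest_sigma_algebra _ setT (range (@cylinder S)).
by move=> /[apply]; rewrite setTD.
Qed.

Lemma mevent_bigcup (F : nat -> set (nat -> S)) :
  (forall n, mevent (F n)) -> mevent (\bigcup_n F n).
Proof.
by have [_ _] := @smallest_sigma_algebra _ setT (range (@cylinder S)); exact.
Qed.

Lemma mevent_bigcap (F : nat -> set (nat -> S)) :
  (forall n, mevent (F n)) -> mevent (\bigcap_n F n).
Proof.
move=> mF; rewrite -[X in mevent X]setCK; apply: meventC; rewrite setC_bigcap.
by apply: mevent_bigcup => n; exact: meventC.
Qed.

Lemma meventT : mevent (setT : set (nat -> S)).
Proof. by rewrite -setC0; apply: meventC; exact: mevent0. Qed.

Lemma meventU E E' : mevent E -> mevent E' -> mevent (E `|` E').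
Proof.
move=> mE mE'; rewrite -bigcup2E; apply: mevent_bigcup => -[|[|n]] //=.
exact: mevent0.
Qed.

Lemma meventI E E' : mevent E -> mevent E' -> mevent (E `&` E').
Proof.
move=> mE mE'; rewrite -[X in mevent X]setCK setCI.
by apply: meventC; apply: meventU; exact: meventC.
Qed.

Lemma mevent_mkseq n (Q : set (seq S)) : mevent [set r | Q (mkseq r n)].
Proof.
have -> : [set r | Q (mkseq r n)] = \bigcup_i
   (if pickle_inv i is Some w then
     if `[< Q w /\ size w = n >] then cylinder w else set0 else set0).
  apply/seteqP; split=> r /=.
    move=> Qr; exists (pickle (mkseq r n)) => //; rewrite pickleK_inv.
    by case: asboolP => [_|[]]; rewrite /cylinder/= size_mkseq.
  move=> [i _]; case: pickle_inv => [w|//]; case: asboolP => [[Qw <-]|//].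
  by rewrite /cylinder/= => ->.
apply: mevent_bigcup => i; case: pickle_inv => [w|]; last exact: mevent0.
by case: ifP => _; [exact: mevent_cylinder|exact: mevent0].
Qed.

Lemma mevent_coord n (Q : set S) : mevent [set r | Q (r n)].
Proof.
pose Q' (w : seq S) := if w is x :: _ then Q (nth x w n) else False.
have -> : [set r | Q (r n)] = [set r | Q' (mkseq r n.+1)].
  have Q'E r : Q' (mkseq r n.+1) = Q (nth (r 0%N) (mkseq r n.+1) n) by [].
  by apply/funext => r; rewrite /mkset Q'E nth_mkseq.
exact: mevent_mkseq.
Qed.

Lemma scons_cylinder (s x : S) (w : seq S) : scons s @^-1` cylinder (x :: w) =
  if s == x then cylinder w else set0 :> set (nat -> S).
Proof.
have mk r : mkseq (scons s r) (size w).+1 = s :: mkseq r (size w).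
  by rewrite /mkseq /= -[1%N]addn0 iotaDl -map_comp.
case: eqVneq => [<-|sx]; apply/seteqP; split=> r //=; rewrite /cylinder/= mk.
- by case.
- by move=> ->.
- by move=> [/eqP]; rewrite (negPf sx).
Qed.

Lemma mevent_scons s E : mevent E -> mevent (scons s @^-1` E).
Proof.
move: E; apply: smallest_sub.
  split=> [|E|F mF]; rewrite /=.
  - by rewrite preimage_set0; exact: mevent0.
  - by move=> mE; rewrite setTD preimage_setC; exact: meventC.
  - by rewrite preimage_bigcup; exact: mevent_bigcup.
move=> _ [w _ <-] /=; case: w => [|x w].
  rewrite (_ : _ @^-1` _ = setT); first exact: meventT.
  by apply/seteqP; split.
rewrite scons_cylinder; case: ifP => _; [exact: mevent_cylinder|exact: mevent0].
Qed.

End events.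

Section scons_meas.
Variables (S : countType) (s t : S).

Definition scons_path : path_space t -> path_space s := scons s.

Lemma measurable_scons : measurable_fun [set: path_space t] scons_path.
Proof.
move=> _ E mE; rewrite setTI; exact: mevent_scons.
Qed.

HB.instance Definition _ :=
  isMeasurableFun.Build _ _ (path_space t) (path_space s) scons_path measurable_scons.

End scons_meas.

(** * First-step decomposition of the path measure *)

Section one_step.
Variables (R : realType) (S : countType) (M : mdp R S).
Implicit Types (sigma : strategy M) (s t : S) (E : set (nat -> S)).

Definition after sigma s : strategy M :=
  @Strategy R S M (fun rho => strat_distr sigma (s :: rho))
    (fun rho => @strat_distrP R S M sigma (s :: rho)).

Lemma path_prob_after sigma s rho t w :
  path_prob (next_distr (after sigma s)) rho t w =
  path_prob (next_distr sigma) (s :: rho) t w.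
Proof. by elim: w rho t => //= u w IH rho t; rewrite IH. Qed.

Definition pr sigma s E : R := fine (Pr sigma s E).

Lemma prE sigma s E : mevent E -> Pr sigma s E = (pr sigma s E)%:E.
Proof.
by move=> mE; rewrite fineK//; apply: fin_num_measure; rewrite -meventE.
Qed.

Lemma pr01 sigma s E : mevent E -> 0 <= pr sigma s E <= 1.
Proof.
move=> mE; rewrite -!lee_fin -prE// measure_ge0/=.
by apply: probability_le1; rewrite -meventE.
Qed.

Lemma le_pr sigma s E E' : mevent E -> mevent E' -> E `<=` E' ->
  pr sigma s E <= pr sigma s E'.
Proof.
move=> mE mE' EE'; rewrite -!lee_fin -!prE//.
by apply: le_measure => //; rewrite inE -meventE.
Qed.

(** [path_space s] contains all sequences, but those not starting in [s] form a null set. *)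
Lemma le_pr_start sigma s E E' : mevent E -> mevent E' ->
  (forall r, r 0%N = s -> E r -> E' r) -> pr sigma s E <= pr sigma s E'.
Proof.
move=> mE mE' EE'.
have mc : mevent (@cylinder S [:: s]) by exact: mevent_cylinder.
have null : Pr sigma s (~` cylinder [:: s]) = 0%E.
  rewrite probability_setC; last by rewrite -meventE.
  by rewrite Pr_cylinder/= subee.
rewrite -lee_fin -!prE//.
apply: (@le_trans _ _ (Pr sigma s (E' `|` ~` cylinder [:: s]))).
  apply: le_measure; rewrite ?inE -?meventE//.
    by apply: meventU => //; exact: meventC.
  move=> r Er; have [rs|rs] := pselect (r 0%N = s); [left; exact: EE'|right].
  by rewrite /cylinder/= => -[].
apply: le_trans (measureU2 _ _ _) _; rewrite -?meventE//; first exact: meventC.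
by rewrite -[leRHS]adde0; apply: leeD => //; rewrite le_eqVlt; apply/orP; left; apply/eqP; exact: null.
Qed.

Lemma pr0_start sigma s E : mevent E -> (forall r, r 0%N = s -> ~ E r) ->
  pr sigma s E = 0.
Proof.
move=> mE E0; apply/eqP; rewrite eq_le; have /andP[-> _] := pr01 sigma s mE.
rewrite andbT; apply: le_trans (le_pr_start _ mE (@mevent0 S) _) _.
  by move=> r rs /E0; exact.
by rewrite /pr measure0.
Qed.

Lemma nd_dist sigma rho s : dist (next_distr sigma rho s).
Proof. exact: is_distr_dist (next_distrP sigma rho s). Qed.

Section mixture.
Variables (sigma : strategy M) (s : S).
Let p := next_distr sigma [::] s.
Let p0 t : 0 <= p t. Proof. exact/dist_ge0/nd_dist. Qed.

Let mix (i : nat) : {measure set (path_space s) -> \bar R} :=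
  if pickle_inv i is Some t then
    mscale (NngNum (p0 t))
      (distribution (Pr (after sigma s) t) (@scons_path S s t))
  else mzero.

Let mixE E : mevent E ->
  mseries mix 0 E = (Ex p (fun t => pr (after sigma s) t (scons s @^-1` E)))%:E.
Proof.
move=> mE; rewrite /mseries /Ex -EFin_lim; last first.
  apply: Ex_cvg; first exact: nd_dist.
  by apply: bnd01 => t; apply: pr01; exact: mevent_scons.
congr (limn _); apply/funext => n; rewrite /series /= -sumEFin.
apply: eq_bigr => i _; rewrite /mix /enc; case: pickle_inv => [t|//].
by rewrite /mscale/= /distribution /pushforward EFinM -prE//; exact: mevent_scons.
Qed.

Let mixT : mseries mix 0 setT = 1%E.
Proof.
rewrite mixE; last exact: meventT.
have -> : (fun t => pr (after sigma s) t (scons s @^-1` setT)) = fun=> 1.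
  by apply/funext => t; rewrite preimage_setT /pr probability_setT.
by rewrite Ex_cst//; exact: nd_dist.
Qed.

HB.instance Definition _ := Measure.on (mseries mix 0).
HB.instance Definition _ :=
  Measure_isProbability.Build _ _ _ (mseries mix 0) mixT.

(** The residual laws, prefixed by [s] and mixed with the weights of the first step, give each
    cylinder at [s] its path probability; uniqueness identifies this mixture with the path
    measure. *)
Lemma pr_step E : mevent E -> pr sigma s E =
  Ex (next_distr sigma [::] s) (fun t => pr (after sigma s) t (scons s @^-1` E)).
Proof.
move=> mE; apply: EFin_inj; rewrite -prE// -mixE//.
apply: (path_measure_unique (k := next_distr sigma)
   (mu := Pr sigma s) (nu := mseries mix 0 : probability (path_space s) R)).
- exact: Pr_cylinder.
- move=> w; apply: etrans (mixE (mevent_cylinder _)) _.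
  rewrite scons_cylinder eqxx; congr EFin.
  case: w => [|u w].
    rewrite (_ : (fun t => _) = fun=> 1) ?Ex_cst ?path_prob0//; first exact: nd_dist.
    apply/funext => t; rewrite /pr (_ : cylinder [::] = setT) ?probability_setT//.
    by apply/seteqP; split.
  set c := path_prob (next_distr (after sigma s)) [::] u w.
  rewrite (_ : (fun t => _) = (fun t => c * dirac_at R u t)).
    rewrite ExZ; [|exact: nd_dist|exact: bnd_dirac].
    rewrite Ex_term1; last exact: nd_dist.
    by rewrite mulrC /c path_prob_after.
  apply/funext => t; rewrite /dirac_at; case: (t =P u) => [->|tu].
    by rewrite mulr1 /pr Pr_cylinder.
  rewrite mulr0 pr0_start//; first exact: mevent_cylinder.
  by move=> r rt; rewrite /cylinder/= => -[ru _]; apply: tu; rewrite -rt.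
- by rewrite -meventE.
Qed.

End mixture.
End one_step.

Lemma mevent_finite (S : countType) n (E : set (nat -> S)) :
  (forall r r', mkseq r n = mkseq r' n -> E r -> E r') -> mevent E.
Proof.
move=> En; have -> : E = [set r | [set w | exists2 r', E r' & mkseq r' n = w] (mkseq r n)].
  apply/seteqP; split=> r /=; first by move=> Er; exists r.
  by move=> [r' Er' /En]; apply.
exact: mevent_mkseq.
Qed.

Lemma mevent_history (S : countType) n (Q : seq S -> S -> Prop) :
  mevent [set r | Q (mkseq r n) (r n)].
Proof.
apply: (@mevent_finite _ n.+1) => r r' rr' /=.
have -> : r n = r' n.
  by have := congr1 (fun w => nth (r n) w n) rr'; rewrite !nth_mkseq.
suff -> : mkseq r n = mkseq r' n by [].
have := congr1 (take n) rr'.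
by rewrite /mkseq -!map_take take_iota (minn_idPl _).
Qed.

Lemma mkseq_recl (S : Type) (r : nat -> S) n : mkseq r n.+1 = r 0%N :: mkseq (r \o succn) n.
Proof. by rewrite /mkseq /= -[1%N]addn0 iotaDl -map_comp. Qed.

(** * Limits of events and bounded submartingales *)

Section pr_limits.
Variables (R : realType) (S : countType) (M : mdp R S).
Implicit Types (sigma tau : strategy M) (s t : S) (E : set (nat -> S)).

Lemma pr_setT sigma s : pr sigma s setT = 1.
Proof. by rewrite /pr probability_setT. Qed.

Lemma pr_setC sigma s E : mevent E -> pr sigma s (~` E) = 1 - pr sigma s E.
Proof.
move=> mE; apply: EFin_inj; rewrite -prE; last exact: meventC.
by rewrite probability_setC -?meventE// prE.
Qed.

Lemma prU sigma s E E' : mevent E -> mevent E' ->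
  pr sigma s (E `|` E') <= pr sigma s E + pr sigma s E'.
Proof.
move=> mE mE'; rewrite -lee_fin EFinD -!prE//; last exact: meventU.
by apply: measureU2; rewrite -meventE.
Qed.

Lemma pr_bigcup_le sigma s (F : nat -> set (nat -> S)) x :
  (forall n, mevent (F n)) -> (forall m n, (m <= n)%N -> F m `<=` F n) ->
  (forall n, pr sigma s (F n) <= x) -> pr sigma s (\bigcup_n F n) <= x.
Proof.
move=> mF ndF Fx; have mU := mevent_bigcup mF.
have h : Pr sigma s \o F @ \oo --> Pr sigma s (\bigcup_n F n).
  apply: nondecreasing_cvg_mu => //.
  by move=> m n mn; apply/subsetPset; exact: ndF.
rewrite -lee_fin -prE//.
have <- := cvg_lim (@ereal_hausdorff R) h.
apply: lime_le; first by apply/cvg_ex; eexists; exact: h.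
by apply: nearW => n /=; rewrite prE// lee_fin.
Qed.

Lemma pr_bigcap_ge sigma s (F : nat -> set (nat -> S)) x :
  (forall n, mevent (F n)) -> (forall m n, (m <= n)%N -> F n `<=` F m) ->
  (forall n, x <= pr sigma s (F n)) -> x <= pr sigma s (\bigcap_n F n).
Proof.
move=> mF niF Fx.
have := @pr_bigcup_le sigma s (fun n => ~` F n) (1 - x).
rewrite -setC_bigcap pr_setC; last exact: mevent_bigcap.
move=> h; suff : 1 - pr sigma s (\bigcap_n F n) <= 1 - x by lra.
apply: h => [n|m n mn|n]; first exact: meventC.
  by apply: subsetC; exact: niF.
by rewrite pr_setC// lerB.
Qed.

Lemma pr_bigcup0 sigma s (F : nat -> set (nat -> S)) :
  (forall n, mevent (F n)) -> (forall n, pr sigma s (F n) = 0) ->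
  pr sigma s (\bigcup_n F n) = 0.
Proof.
move=> mF F0; apply: EFin_inj; rewrite -prE; last exact: mevent_bigcup.
apply/eqP; rewrite eq_le measure_ge0 andbT.
have -> : 0%:E = (\sum_(0 <= n <oo) Pr sigma s (F n))%E.
  by rewrite eseries0// => n _ _; rewrite prE// F0.
apply: measure_sigma_subadditive => //; rewrite -?meventE//.
exact: mevent_bigcup.
Qed.

(** [head t rho] is the first state of the history [rcons rho t]; only histories that begin with [s]
    matter for paths from [s]. *)
Lemma pr_eq sigma tau s E : mevent E ->
  (forall rho t, head t rho = s -> next_distr sigma rho t = next_distr tau rho t) ->
  pr sigma s E = pr tau s E.
Proof.
move=> mE st; rewrite /pr; congr fine.
apply: (path_measure_unique (k := next_distr sigma)).
- exact: Pr_cylinder.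
- move=> w; rewrite Pr_cylinder; congr EFin.
  suff h : forall w rho t, head t rho = s -> path_prob (next_distr tau) rho t w =
      path_prob (next_distr sigma) rho t w by exact: h.
  elim=> //= u {}w IH rho t rs; rewrite st// IH//.
  by case: rho rs.
- by rewrite -meventE.
Qed.

(** At each time the mean of [H] is at least its initial value and, as [H <= 1], at most [e] plus
    the probability of exceeding [e]. Continuity from above turns this uniform bound into one for
    exceeding [e] infinitely often. *)
Lemma submartingale_often sigma s (H : seq S -> S -> R) e :
  (forall rho t, 0 <= H rho t <= 1) -> 0 <= e ->
  (forall rho t, H rho t <= Ex (next_distr sigma rho t) (H (rcons rho t))) ->
  H [::] s - e <=
    pr sigma s [set r | forall m, exists n, (m <= n)%N /\ e < H (mkseq r n) (r n)].
Proof.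
move=> H01 e0 Hsub; pose F n : set (nat -> S) := [set r | e < H (mkseq r n) (r n)].
have mF (K : seq S -> S -> R) n := mevent_history n (fun rho t => e < K rho t).
have level n : H [::] s - e <= pr sigma s (F n).
  rewrite /F {F}; move: sigma s H H01 Hsub.
  elim: n => [|n IH] sigma s H H01 Hsub.
    have := H01 [::] s; have [eH|He] := ltP e (H [::] s); last first.
      move=> _; apply: (@le_trans _ _ 0); first by rewrite subr_le0.
      by have /andP[] := pr01 sigma s (mF H 0%N).
    move=> /andP[_ H1]; apply: (@le_trans _ _ (pr sigma s setT)).
      by rewrite pr_setT; lra.
    by apply: (le_pr_start _ (@meventT S) (mF H 0%N)) => r /= ->.
  rewrite (pr_step _ _ (mF H n.+1)).
  have dp := nd_dist sigma [::] s.
  apply: le_trans (lerB (Hsub [::] s) (lexx e)) _.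
  have bH : bnd (H [:: s]) by exact/bnd01/H01.
  rewrite -[X in _ - X](Ex_cst e dp) -ExB//; last exact: bnd_cst.
  apply: Ex_le => //.
  - by apply: bndB => //; exact: bnd_cst.
  - by apply: bnd01 => t; apply: pr01; exact: (mevent_scons _ (mF H n.+1)).
  - move=> t _; apply: le_trans (IH (after sigma s) t (fun rho => H (s :: rho)) _ _) _.
    - by move=> rho u; exact: H01.
    - by move=> rho u; exact: (Hsub (s :: rho) u).
    apply: le_pr; [exact: (mF (fun rho => H (s :: rho)))|exact: (mevent_scons _ (mF H n.+1))|].
    by move=> r /=; rewrite mkseq_recl.
have mG m : mevent (\bigcup_n F (n + m)%N) by apply: mevent_bigcup => n; exact: mF.
apply: (@le_trans _ _ (pr sigma s (\bigcap_m \bigcup_n F (n + m)%N))); last first.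
  apply: le_pr; first exact: mevent_bigcap.
    have -> : [set r | forall m, exists n, (m <= n)%N /\ e < H (mkseq r n) (r n)] =
       \bigcap_m \bigcup_n F (n + m)%N.
      apply/seteqP; split=> r /=.
        move=> h m _; have [n [mn en]] := h m; exists (n - m)%N => //.
        by rewrite /F/= subnK.
      move=> h m; have [n _ en] := h m I; exists (n + m)%N; split=> //.
      exact: leq_addl.
    exact: mevent_bigcap.
  move=> r /= h m; have [n _ en] := h m I; exists (n + m)%N; split=> //.
  exact: leq_addl.
apply: pr_bigcap_ge => // [m n mn r [k _ Fk]|m].
  by exists (k + (n - m))%N => //; rewrite -addnA subnK.
apply: le_trans (level m) _; apply: le_pr => //; first exact: mF.
by move=> r Fr; exists 0%N.
Qed.

End pr_limits.

(** * Admissible choices and the strategies made of them *)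

Section strategies.
Variables (R : realType) (S : countType) (M : mdp R S).
Implicit Types (s t : S) (p : S -> R).

Definition legal s p := is_distr (step M s) p /\
  (~~ controlled M s -> p = random_step M s).

(** Only deterministic choices form the house of the MDP, so that a policy taken in it is MD;
    [cond_mix] relates randomised strategies to it. *)
Definition pure s p := if controlled M s then exists2 t, step M s t & p = dirac_at R t
  else p = random_step M s.

Lemma legal_next (sigma : strategy M) rho s : legal s (next_distr sigma rho s).
Proof.
split; first exact: next_distrP.
by rewrite /next_distr => /negPf ->.
Qed.

Lemma pure_legal s p : pure s p -> legal s p.
Proof.
rewrite /pure /legal; case: ifPn => [cs [t st ->]|rs ->]; split=> //.
  exact: dirac_at_distr.
exact: random_stepP.
Qed.

Lemma legal_dirac s t : controlled M s -> step M s t -> legal s (dirac_at R t).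
Proof. by move=> cs st; apply: pure_legal; rewrite /pure cs; exists t. Qed.

Lemma legal_dist s p : legal s p -> dist p.
Proof. by case=> /is_distr_dist. Qed.

Lemma pure_dist s p : pure s p -> dist p.
Proof. by move/pure_legal/legal_dist. Qed.

Lemma pure_house : house pure.
Proof.
move=> s; split; last exact: pure_dist.
case cs : (controlled M s).
  have [t st] := step_total M s; exists (dirac_at R t).
  by rewrite /pure cs; exists t.
by exists (random_step M s); rewrite /pure cs.
Qed.

Section strategy_of.
Variables (a : seq S -> S -> S -> R) (la : forall rho s, legal s (a rho s)).

Definition strategy_of : strategy M :=
  @Strategy R S M a (fun rho s _ => (la rho s).1).

Lemma strategy_ofE rho s : next_distr strategy_of rho s = a rho s.
Proof.
by rewrite /next_distr; case: ifPn => // /((la rho s).2) ->.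
Qed.

End strategy_of.

Lemma strategy_ex : strategy M.
Proof.
have /choice[a aP] : forall s, exists p, pure s p by move=> s; case: (pure_house s).
exact: (strategy_of (fun _ s => pure_legal (aP s))).
Qed.

End strategies.

(** * Transience *)

Lemma mevent_inf_often (S : countType) (Q : set S) : mevent (inf_often Q).
Proof.
have -> : inf_often Q = \bigcap_m \bigcup_n [set r | (m <= n)%N /\ Q (r n)].
  apply/seteqP; split=> r h m; first by move=> _; have [n] := h m; exists n.
  by have [n _] := h m I; exists n.
apply: mevent_bigcap => m; apply: mevent_bigcup => n.
exact: (mevent_coord n (fun t => (m <= n)%N /\ Q t)).
Qed.

Section transience.
Variables (R : realType) (S : countType) (M : mdp R S).
Hypothesis transM : universally_transient M.

Lemma mevent_run : mevent (run M).
Proof.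
have -> : run M = \bigcap_i [set r | step M (r i) (r i.+1)].
  by apply/seteqP; split=> r h i; [move=> _|]; exact: h.
apply: mevent_bigcap => i; apply: (@mevent_finite _ i.+2) => r r' rr' /=.
have e j : (j < i.+2)%N -> r j = r' j.
  by move=> ji; have := congr1 (fun w => nth (r j) w j) rr'; rewrite !nth_mkseq.
by rewrite !e.
Qed.

Lemma mevent_transience : mevent (transience M).
Proof.
have -> : transience M = run M `&` \bigcap_i
    [set r | forall s, pickle s = i -> ~ inf_often [set s] r].
  apply/seteqP; split=> r /= -[rr h]; split=> //.
    by move=> i _ s _; exact: h.
  by move=> s; exact: (h (pickle s) I s erefl).
apply: meventI; first exact: mevent_run.
apply: mevent_bigcap => i.
have [[s si]|ns] := pselect (exists s : S, pickle s = i).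
  rewrite (_ : [set r | _] = ~` inf_often [set s]).
    by apply: meventC; exact: mevent_inf_often.
  apply/seteqP; split=> r /=; first exact.
  by move=> rs s'; rewrite -si => /(pcan_inj (@pickleK _)) ->.
rewrite (_ : [set r | _] = setT); first exact: meventT.
by apply/seteqP; split=> // r _ s si; case: ns; exists s.
Qed.

Lemma pr_transience (sigma : strategy M) s : pr sigma s (transience M) = 1.
Proof. by rewrite /pr transM. Qed.

Lemma pr_run (sigma : strategy M) s : pr sigma s (run M) = 1.
Proof.
apply/eqP; rewrite eq_le; have /andP[_ ->] := pr01 sigma s mevent_run.
rewrite -(pr_transience sigma s); apply: le_pr.
- exact: mevent_transience.
- exact: mevent_run.
- by move=> r [].
Qed.

Lemma pr_inf_often1 (sigma : strategy M) s x : pr sigma s (inf_often [set x]) = 0.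
Proof.
have mi := mevent_inf_often [set x].
apply/eqP; rewrite eq_le; have /andP[-> _] := pr01 sigma s mi; rewrite andbT.
have := pr_transience sigma s; have mt := mevent_transience.
have : pr sigma s (transience M) <= pr sigma s (~` inf_often [set x]).
  by apply: le_pr => //; [exact: meventC|move=> r [_]; exact].
by rewrite pr_setC//; lra.
Qed.

(* If the supremum of the return probabilities were 1, then one could play
   with ever smaller losses after each return, and come back infinitely often
   with positive probability. *)
Lemma return_lt1 x : exists2 k : R, k < 1 &
  forall p, pure M x p -> Ex p (reach (pure M) [set x]) <= k.
Proof.
apply: contrapT => /forall2NP nk.
have hA := pure_house M.
(* The ratio [c n / c n.+1] is the return probability demanded at stage [n]. The ratios telescope,
   and [c 1], which is 3/4, leaves a margin above the threshold 1/2 used below. *)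
pose c (n : nat) : R := 1 - 2^-1 ^+ n.+1.
have c2 n : 0 < (2^-1 : R) ^+ n.+1 <= 1 / 2.
  rewrite exprn_gt0//= exprS -[leRHS]mulr1 mul1r ler_wpM2l//.
  by apply: exprn_ile1; lra.
have c01 n : 1 / 2 <= c n < 1 by have := c2 n; rewrite /c; lra.
have cS n : c n < c n.+1.
  rewrite /c [_ ^+ n.+2]exprS; have := c2 n; set y := _ ^+ n.+1; lra.
have stage n : exists G : R * (S -> R) * (S -> S -> R),
    let: (d, w, a) := G in
    [/\ 0 <= d < 1, forall t, 0 <= w t <= 1, w x = 1, c n < c n.+1 * Ex (a x) w &
     forall s, pure M s (a s) /\ (s != x -> w s <= d * Ex (a s) w)].
  have kn : c n / c n.+1 < 1.
    by rewrite ltr_pdivrMr ?mul1r//; have := c01 n.+1; lra.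
  case: (nk (c n / c n.+1)) => [//|/existsNP[p /not_implyP[Ap /negP]]].
  rewrite -ltNge => np.
  have [d [w [b [d01 w01 wT xw bP]]]] := reach_discount hA (pure_dist Ap) np.
  exists (d, w, fun s => if s == x then p else b s); split=> //.
  - exact: (wT x erefl).
  - rewrite eqxx -ltr_pdivrMl; last by have := c01 n.+1; lra.
    by rewrite mulrC.
  - move=> s; case: eqVneq => [->//|sx]; split; first by case: (bP s).
    by move=> _; apply: (bP s).2 => /= /eqP; rewrite (negPf sx).
have /choice[G GP] := stage.
pose d n := (G n).1.1; pose w n := (G n).1.2; pose a n := (G n).2.
have {stage}GP n : [/\ 0 <= d n < 1, forall t, 0 <= w n t <= 1, w n x = 1,
    c n < c n.+1 * Ex (a n x) (w n) &
    forall s, pure M s (a n s) /\ (s != x -> w n s <= d n * Ex (a n s) (w n))].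
  by have := GP n; rewrite /d /w /a; case: (G n) => -[].
clearbody d w a; clear G nk.
(* The stage is the number of visits to [x], the current state included. *)
pose alpha rho s := a (count_mem x (rcons rho s)) s.
have lalpha rho s : legal M s (alpha rho s).
  by apply: pure_legal; have [_ _ _ _ /(_ s)[]] := GP (count_mem x (rcons rho s)).
(* The submartingale: [count_mem x rho] counts the earlier visits and [index x (rev rho)] the states
   passed since the last one, so the discount makes [H] small after a long absence from [x]. *)
pose H rho s := c (count_mem x rho).+1 *
  (d (count_mem x rho) ^+ index x (rev rho) * w (count_mem x rho) s).
have d01 n j : 0 <= d n ^+ j <= 1.
  by have [/andP[d0 d1] _ _ _ _] := GP n; rewrite exprn_ge0//= exprn_ile1// ltW.
have H01 rho s : 0 <= H rho s <= 1.
  rewrite /H; set n := count_mem _ _; have := d01 n (index x (rev rho)).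
  have [_ /(_ s) + _ _ _] := GP n; have := c01 n.+1.
  set cn := c _; set e := _ ^+ _; set v := w _ _ => cb /andP[v0 v1] /andP[e0 e1].
  have ev0 : 0 <= e * v by rewrite mulr_ge0.
  have ev1 : e * v <= 1 by rewrite mulr_ile1.
  by apply/andP; split; [rewrite mulr_ge0//; lra|rewrite mulr_ile1//; lra].
have := @submartingale_often _ _ M (strategy_of lalpha) x H (1 / 2) H01.
have -> : H [::] x = c 1%N.
  by rewrite /H/=; have [_ _ -> _ _] := GP 0%N; rewrite expr0 !mulr1.
have half0 : 0 <= (1 / 2 : R) by lra.
move=> /(_ half0) often; suff : c 1%N - 1 / 2 <= 0.
  by rewrite /c !exprS expr0; lra.
rewrite -(pr_inf_often1 (strategy_of lalpha) x x).
apply: (le_trans (often _)).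
- move=> rho t; rewrite strategy_ofE; set p := alpha rho t.
  set n' := count_mem x (rcons rho t); set j' := index x (rev (rcons rho t)).
  have dp : dist p by exact: legal_dist (lalpha rho t).
  have [_ w01 _ _ _] := GP n'.
  have -> : Ex p (H (rcons rho t)) = c n'.+1 * (d n' ^+ j' * Ex p (w n')).
    rewrite -ExZ//; last exact: bnd01.
    by rewrite -ExZ//; apply: bndZ; exact: bnd01.
  rewrite /H /p /alpha -/n'; set n := count_mem x rho.
  have := c01 n.+1; rewrite /n' /j' -cats1 count_cat cats1 rev_rcons /= addn0 addnC.
  have [->|tx] := eqVneq t x.
    move=> cb; rewrite expr0 mul1r add1n.
    have [_ _ _ /ltW h _] := GP n.+1; apply: le_trans h.
    rewrite ger_pMr; last by lra.
    have [_ /(_ x)/andP[w0 w1] _ _ _] := GP n.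
    by case/andP: (d01 n (index x (rev rho))) => ? ?; rewrite mulr_ile1.
  move=> cb; rewrite add0n ler_wpM2l//; first by lra.
  rewrite exprSr -mulrA ler_wpM2l//; first by case/andP: (d01 n (index x (rev rho))).
  by have [_ _ _ _ /(_ t)[_ /(_ tx)]] := GP n.
have mio : mevent [set r | forall m, exists n, (m <= n)%N /\ 1 / 2 < H (mkseq r n) (r n)].
  have -> : [set r | forall m, exists n, (m <= n)%N /\ 1 / 2 < H (mkseq r n) (r n)] =
      \bigcap_m \bigcup_n [set r | (m <= n)%N /\ 1 / 2 < H (mkseq r n) (r n)].
    apply/seteqP; split=> r h m; first by move=> _; have [n] := h m; exists n.
    by have [n _] := h m I; exists n.
  apply: mevent_bigcap => m; apply: mevent_bigcup => n.
  exact: (mevent_history n (fun rho t => (m <= n)%N /\ 1 / 2 < H rho t)).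
apply: le_pr => //; first exact: mevent_inf_often.
(* Without a visit to [x] from time [m] on, the stage is frozen while the exponent of its discount
   grows, so [H] eventually stays at most 1/2. *)
move=> r /= Hr; apply: contrapT => /existsNP[m /forallNP rm].
have {}rm n : (m <= n)%N -> r n != x.
  by move=> mn; apply/eqP => rx; apply: (rm n).
pose N := count_mem x (mkseq r m).
have mk k : mkseq r (m + k) = mkseq r m ++ [seq r i | i <- iota m k].
  by rewrite /mkseq iotaD map_cat.
have nx k : x \notin [seq r i | i <- iota m k].
  by apply/mapP => -[i]; rewrite mem_iota => /andP[/rm + _] => /[swap] <-; rewrite eqxx.
have cN k : count_mem x (mkseq r (m + k)) = N.
  by rewrite mk count_cat -/N (count_memPn (nx k)) addn0.
have jk k : (k <= index x (rev (mkseq r (m + k))))%N.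
  rewrite mk rev_cat index_cat mem_rev (negPf (nx k)) size_rev size_map size_iota.
  exact: leq_addr.
have [/andP[d0 d1] w01 _ _ _] := GP N.
have /cvgrPdist_lt/(_ (1 / 2)) : (fun k => d N ^+ k) @ \oo --> (0 : R).
  by apply: cvg_expr; rewrite ger0_norm.
have half : 0 < (1 / 2 : R) by lra.
move=> /(_ half)[k _ /(_ k (leqnn k))] /=; rewrite sub0r normrN ger0_norm ?exprn_ge0// => dk.
have [n [mn]] := Hr (m + k)%N.
have -> : n = (m + (n - m))%N by lia.
rewrite /H cN; apply/negP; rewrite -leNgt.
set j := index _ _; have kj : (k <= j)%N.
  by apply: leq_trans (jk (n - m)%N); lia.
have dj : d N ^+ j <= 1 / 2.
  by apply: le_trans (ltW dk); rewrite ler_wiXn2l// ltW.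
have := c01 N.+1; have /andP[w0 w1] := w01 (r (m + (n - m))%N).
set v := w _ _ in w0 w1 *; set e := _ ^+ j in dj *.
have e0 : 0 <= e by rewrite exprn_ge0.
have ev : e * v <= e by rewrite ler_piMr.
move=> /andP[c0 c1]; apply: le_trans dj; apply: le_trans ev.
by rewrite ler_piMl ?mulr_ge0// ltW.
Qed.
End transience.

(** * Conditioning on winning *)

Section winning.
Variables (S : countType) (col : S -> 'I_3).

Definition color (c : nat) : set S := [set s | col s = c :> nat].

Definition eventually0 : set (nat -> S) :=
  [set r | exists m, forall n, (m <= n)%N -> color 0 (r n)].

(** The parity objective without the condition [run], which holds almost surely; dropping it makes
    the event invariant under prefixing any state. *)
Definition win : set (nat -> S) := inf_often (color 2) `|` eventually0.

Lemma mevent_eventually0 : mevent eventually0.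
Proof.
have -> : eventually0 = \bigcup_m \bigcap_n [set r | (m <= n)%N -> color 0 (r n)].
  apply/seteqP; split=> r [m]; first by move=> h; exists m => // n _; exact: h.
  by move=> _ h; exists m => n; exact: h.
apply: mevent_bigcup => m; apply: mevent_bigcap => n.
exact: (mevent_coord n (fun t => (m <= n)%N -> color 0 t)).
Qed.

Lemma mevent_win : mevent win.
Proof.
by apply: meventU; [exact: mevent_inf_often|exact: mevent_eventually0].
Qed.

Lemma scons_inf_often (s : S) Q : scons s @^-1` inf_often Q = inf_often Q.
Proof.
apply/seteqP; split=> r h m; first by have [[|n] [mn Qn]] := h m.+1 => //; exists n.
by have [n [mn Qn]] := h m; exists n.+1; split=> //; exact: leqW.
Qed.

Lemma scons_eventually0 (s : S) : scons s @^-1` eventually0 = eventually0.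
Proof.
apply/seteqP; split=> r [m h]; first by exists m => n mn; exact: (h n.+1 (leqW mn)).
by exists m.+1 => -[|n] mn //; exact: h.
Qed.

Lemma scons_win (s : S) : scons s @^-1` win = win.
Proof. by rewrite /win preimage_setU scons_inf_often scons_eventually0. Qed.

Lemma color_cases s : [\/ color 0 s, color 1 s | color 2 s].
Proof.
rewrite /color/=; have := ltn_ord (col s); case: (nat_of_ord (col s)) => [|[|[|//]]] _.
- by apply: Or31.
- by apply: Or32.
- by apply: Or33.
Qed.

Lemma parityE (R : realType) (M : mdp R S) : parity M col = run M `&` win.
Proof.
have val_eq (c : 'I_3) : [set s | col s = c] = color c.
  by apply/seteqP; split=> s /=; rewrite /color/=; [move=> ->|exact: val_inj].
apply/seteqP; split=> r [rr].
  move=> [c [ec ic maxc]]; split=> //.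
  move: ec ic maxc; rewrite val_eq; have := ltn_ord c.
  case cE : (nat_of_ord c) => [|[|[|//]]] // _ _ ic maxc; [right|by left].
  have never (k : nat) (k3 : (0 < k < 3)%N) : exists m, forall n, (m <= n)%N -> ~ color k (r n).
    apply: contrapT => /forallNP nk.
    case/andP: k3 => k0 k3; have := maxc (Ordinal k3); rewrite val_eq/= leqNgt k0.
    move=> h; suff : false by []; apply: h => m.
    have /existsNP[n /not_implyP[mn kn]] := nk m.
    by exists n; split=> //; exact: contrapT.
  have [m1 h1] := never 1%N isT; have [m2 h2] := never 2%N isT.
  exists (maxn m1 m2) => n; rewrite geq_max => /andP[n1 n2].
  by have [|/(h1 _ n1)|/(h2 _ n2)] := color_cases (r n).
move=> [i2|[m h0]]; split=> //.
  exists (@Ordinal 3 2 isT); split=> //; first by rewrite val_eq.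
  by move=> c' _; rewrite -ltnS; exact: ltn_ord.
exists ord0; split=> //.
  rewrite val_eq => k; exists (maxn m k); split; first exact: leq_maxr.
  by apply: h0; exact: leq_maxl.
move=> c'; rewrite val_eq => /(_ m)[n [mn]]; rewrite /color/= => <-.
by rewrite (h0 n mn).
Qed.

End winning.

(** * The value of winning and the residuals of optimal strategies *)

Section value.
Variables (R : realType) (S : countType) (M : mdp R S) (col : S -> 'I_3).
Implicit Types (sigma : strategy M) (s t : S) (p f : S -> R).

Local Notation win := (win col).
Let mwin := mevent_win col.

Definition win_value s : R := sup [set pr sigma s win | sigma in [set: strategy M]].

Lemma pr_le_win_value sigma s : pr sigma s win <= win_value s.
Proof.
apply: ub_le_sup; last by exists sigma.
by exists 1 => _ [tau _ <-]; have /andP[] := pr01 tau s mwin.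
Qed.

Lemma win_value_approx s e : 0 < e -> exists sigma, win_value s - e < pr sigma s win.
Proof.
move=> e0; have [|_ [sigma _ <-] h] := @sup_adherent _ [set pr sigma s win | sigma in [set: strategy M]] _ e0.
  split; first by exists (pr (strategy_ex M) s win), (strategy_ex M).
  by exists 1 => _ [tau _ <-]; have /andP[] := pr01 tau s mwin.
by exists sigma.
Qed.

Lemma win_value01 s : 0 <= win_value s <= 1.
Proof.
have /andP[w0 _] := pr01 (strategy_ex M) s mwin.
rewrite (le_trans w0 (pr_le_win_value _ _))/=.
apply: ge_sup; first by exists (pr (strategy_ex M) s win), (strategy_ex M).
by move=> _ [tau _ <-]; have /andP[] := pr01 tau s mwin.
Qed.

Let bval : bnd win_value := bnd01 win_value01.

Lemma pr_win_step sigma s : pr sigma s win =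
  Ex (next_distr sigma [::] s) (fun t => pr (after sigma s) t win).
Proof. by rewrite pr_step// scons_win. Qed.

(* Play [p] first, then a nearly optimal strategy from the successor. *)
Lemma win_value_step s p : legal M s p -> Ex p win_value <= win_value s.
Proof.
move=> lp; have dp := legal_dist lp; apply/ler_addgt0Pr => e e0.
have /choice[tau tauP] : forall t, exists sigma, win_value t - e < pr sigma t win.
  by move=> t; exact: win_value_approx.
pose a rho s' := if rho is x :: rho' then next_distr (tau (head s' rho')) rho' s'
  else if s' == s then p else next_distr (strategy_ex M) [::] s'.
have la rho s' : legal M s' (a rho s').
  case: rho => [|x rho]; last exact: legal_next.
  by rewrite /a; case: eqP => [->//|_]; exact: legal_next.
apply: le_trans (lerD (pr_le_win_value (strategy_of la) s) (lexx e)).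
rewrite pr_win_step strategy_ofE /a eqxx -lerBlDr -[X in _ - X](Ex_cst e dp) -ExB//.
  apply: Ex_le => // [||t _].
  - by apply: bndB => //; exact: bnd_cst.
  - by apply: bnd01 => t; exact: pr01.
  - apply: le_trans (ltW (tauP t)) _; rewrite le_eqVlt; apply/orP; left; apply/eqP.
    apply: pr_eq => // rho u ru.
    have -> : next_distr (after (strategy_of la) s) rho u = next_distr (strategy_of la) (s :: rho) u by [].
    by rewrite strategy_ofE /a ru.
exact: bnd_cst.
Qed.

Definition optimal sigma s := pr sigma s win = win_value s.

Section residual.
Variables (sigma : strategy M) (s : S).
Hypothesis os : optimal sigma s.
Let p := next_distr sigma [::] s.
Let dp : dist p. Proof. exact: nd_dist. Qed.

Lemma opt_val : Ex p win_value = win_value s.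
Proof.
apply/eqP; rewrite eq_le win_value_step; last exact: legal_next.
rewrite /= -{1}os pr_win_step; apply: Ex_le => // [|t _]; last exact: pr_le_win_value.
by apply: bnd01 => t; exact: pr01.
Qed.

(** The first step preserves the value on average by [opt_val], so no successor of positive
    probability can fall short of its own value. *)
Lemma opt_after t : 0 < p t -> optimal (after sigma s) t.
Proof.
move=> pt; apply: (@Ex_eq_supp _ _ p (fun u => pr (after sigma s) u win) win_value) => //.
- by apply: bnd01 => u; exact: pr01.
- by move=> u _; exact: pr_le_win_value.
- by rewrite opt_val -os pr_win_step.
Qed.

(** Each successor could also be chosen deterministically, so none has a value above [win_value s],
    while their average equals it. *)
Lemma opt_controlled t : controlled M s -> 0 < p t -> step M s t /\ win_value t = win_value s.
Proof.
move=> cs pt; have [p0 pstep _] := next_distrP sigma [::] s.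
have st u : 0 < p u -> step M s u by move=> pu; apply: pstep; rewrite gt_eqF.
split; first exact: st.
apply: (@Ex_eq_supp _ _ p win_value (fun=> win_value s)) => //; first exact: bnd_cst.
  by move=> u /st su; rewrite -(Ex_dirac u bval); apply/win_value_step/legal_dirac.
by rewrite Ex_cst// opt_val.
Qed.

End residual.

Definition opt_state s := 0 < win_value s /\ exists sigma, optimal sigma s.

Lemma opt_dom sigma s t : optimal sigma s -> 0 < next_distr sigma [::] s t ->
  0 < win_value t -> opt_state t.
Proof. by move=> os pt vt; split=> //; exists (after sigma s); exact: opt_after. Qed.

(* Conditioning on winning turns the value-preserving actions into those of a
   house on [opt_state]; the other states are made absorbing. *)
Definition doob s p t : R := p t * (win_value t / win_value s).

Definition cond s q := if `[< opt_state s >] then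
    exists p, [/\ pure M s p, Ex p win_value = win_value s,
      forall t, 0 < p t -> 0 < win_value t -> opt_state t & q = doob s p]
  else q = dirac_at R s.

Lemma Ex_doob s p f : dist p -> bnd f ->
  Ex (doob s p) f = (win_value s)^-1 * Ex p (fun t => win_value t * f t).
Proof.
move=> dp [K fK]; rewrite /doob Ex_reweight -ExZ//.
  by congr Ex; apply/funext => t; rewrite [win_value t / _]mulrC mulrA.
exists K => t; have := win_value01 t; rewrite normrM => /andP[v0 v1].
by rewrite (ger0_norm v0) (le_trans _ (fK t))// ler_piMl.
Qed.

Lemma doob_dist s p : dist p -> 0 < win_value s -> Ex p win_value = win_value s -> dist (doob s p).
Proof.
move=> dp s0 pv; have hE : (fun t => win_value t / win_value s) = fun t => (win_value s)^-1 * win_value t.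
  by apply/funext => t; rewrite mulrC.
apply: dist_reweight => //; rewrite ?hE; first exact: bndZ.
  by move=> t; rewrite mulr_ge0 ?invr_ge0 ?(ltW s0)//; case/andP: (win_value01 t).
by rewrite ExZ// pv mulVf// gt_eqF.
Qed.

Lemma doob_dirac s t : 0 < win_value s -> win_value t = win_value s -> doob s (dirac_at R t) = dirac_at R t.
Proof.
move=> s0 ts; apply/funext => u; rewrite /doob /dirac_at.
by case: eqP => [->|_]; rewrite ?mul0r// ts divff ?mulr1// gt_eqF.
Qed.

Lemma cond_dom s q : opt_state s -> cond s q -> exists p, [/\ pure M s p, Ex p win_value = win_value s,
      forall t, 0 < p t -> 0 < win_value t -> opt_state t & q = doob s p].
Proof. by move=> Ds; rewrite /cond; case: asboolP. Qed.

(* Randomised optimal choices do not beat the pure ones. *)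
Lemma cond_mix sigma s f e : opt_state s -> optimal sigma s -> (forall t, 0 <= f t <= 1) ->
  0 < e -> exists2 q, cond s q &
    Ex (next_distr sigma [::] s) (fun t => win_value t * f t) <= win_value s * (Ex q f + e).
Proof.
move=> Ds os f01 e0; have bf := bnd01 f01; set p := next_distr _ _ _.
have s0 := Ds.1; have dp : dist p by exact: nd_dist.
have bvf : bnd (fun t => win_value t * f t).
  apply: bnd01 => t; have /andP[v0 v1] := win_value01 t; have /andP[g0 g1] := f01 t.
  by rewrite mulr_ge0//= mulr_ile1.
have [cs|rs] := boolP (controlled M s).
  (* Some successor is nearly as good as the average; at a controlled state all successors have the
     value of [s], so the weight [win_value] factors out. *)
  have [t pt ft] : exists2 t, 0 < p t & Ex p f <= f t + e.
    apply: contrapT => /forall2NP nt; suff : Ex p f <= Ex p f - e by lra.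
    apply: Ex_le_cst => // t pt; case: (nt t) => // /negP; rewrite -ltNge; lra.
  have [st vt] := opt_controlled os cs pt.
  exists (dirac_at R t).
    rewrite /cond; case: asboolP => // _; exists (dirac_at R t); split.
    - by rewrite /pure cs; exists t.
    - by rewrite Ex_dirac.
    - by move=> u /dirac_at_gt0 ->; exact: opt_dom pt.
    - by rewrite doob_dirac.
  rewrite Ex_dirac//; apply: (@le_trans _ _ (win_value s * Ex p f)); last by rewrite ler_wpM2l// ltW.
  rewrite -ExZ//; apply: Ex_le => // [|u pu]; first exact: bndZ.
  by have [_ ->] := opt_controlled os cs pu.
exists (doob s p).
  rewrite /cond; case: asboolP => // _; exists p; split=> //.
  - by rewrite /pure (negPf rs) /p /next_distr (negPf rs).
  - exact: opt_val.
  - by move=> t pt; exact: opt_dom pt.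
rewrite Ex_doob// mulrDr mulrA mulfV ?gt_eqF// mul1r lerDl mulr_ge0// ltW//.
Qed.

Lemma cond_house : house cond.
Proof.
move=> s; split.
  have [Ds|nDs] := pselect (opt_state s); last first.
    by exists (dirac_at R s); rewrite /cond; case: asboolP.
  have [_ [sigma os]] := Ds.
  have [|q cq _] := @cond_mix sigma s (fun=> 0) 1 Ds os _ ltr01; last by exists q.
  by move=> t; rewrite lexx ler01.
move=> q; rewrite /cond; case: asboolP => [Ds [p [pp pv _ ->]]|_ ->].
  by apply: doob_dist => //; [exact: pure_dist pp|exact: Ds.1].
exact: dirac_at_dist.
Qed.

End value.

(** * Returns, safety and almost sure reachability after conditioning *)

Section conditioned.
Variables (R : realType) (S : countType) (M : mdp R S) (col : S -> 'I_3).
Hypothesis transM : universally_transient M.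
Implicit Types (sigma tau : strategy M) (s t : S) (p f : S -> R) (T : set S).

Local Notation win := (win col).
Local Notation win_value := (win_value M col).
Local Notation opt_state := (opt_state M col).
Local Notation optimal := (optimal col).
Local Notation cond := (cond M col).
Local Notation color := (color col).

Let mwin : mevent win := mevent_win col.
Let hC : house cond := @cond_house R S M col.
Let v01 s : 0 <= win_value s <= 1 := win_value01 M col s.
Let bval : bnd win_value := bnd01 v01.

Let bvalf f : (forall t, 0 <= f t <= 1) -> bnd (fun t => win_value t * f t).
Proof.
move=> f01; apply: bnd01 => t; have /andP[u0 u1] := v01 t.
by have /andP[g0 g1] := f01 t; rewrite mulr_ge0//= mulr_ile1.
Qed.

Let bpr sigma (F : S -> strategy M) E : mevent E -> bnd (fun t => pr (F t) t E).
Proof. by move=> mE; apply: bnd01 => t; exact: pr01. Qed.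

(** Conditioning multiplies the weight of a path from [s] to [x] by [win_value x / win_value s], a
    factor that cancels on a loop. So the unconditioned bound is inherited, with the rescaled reach
    value as superharmonic competitor. *)
Lemma cond_return x : opt_state x -> exists2 k : R, k < 1 &
  forall q, cond x q -> Ex q (reach cond [set x]) <= k.
Proof.
move=> Dx; have [k k1 kP] := return_lt1 transM x; exists k => // q cq.
have hA := pure_house M.
set r := reach (pure M) [set x] in kP.
have r01 t : 0 <= r t <= 1 by exact: reach01.
have br := bnd01 r01.
(* The value 1 outside [opt_state] is harmless: seen from [opt_state], such successors have value 0,
   hence weight 0 after conditioning. *)
pose f s := if `[< opt_state s >] then Num.min 1 (win_value x / win_value s * r s) else 1.
have f01 s : 0 <= f s <= 1.
  rewrite /f; case: asboolP => [Ds|_]; last by rewrite ler01 lexx.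
  rewrite ge_min lexx/= andbT le_min ler01/= mulr_ge0// ?divr_ge0//.
  - by case/andP: (v01 x).
  - by case/andP: (v01 s).
  - by case/andP: (r01 s).
have vf s p : dist p -> Ex p win_value = win_value s ->
    (forall t, 0 < p t -> 0 < win_value t -> opt_state t) ->
    Ex p (fun t => win_value t * f t) <= win_value x * Ex p r.
  move=> dp pv pdom; rewrite -ExZ//; apply: Ex_le => // [||t pt].
  - exact: bvalf.
  - exact: bndZ.
  have /andP[vx0 _] := v01 x; have /andP[rt0 _] := r01 t.
  have := v01 t; rewrite le_eqVlt => /andP[/predU1P[<- _|vt _]].
    by rewrite mul0r mulr_ge0.
  rewrite /f; case: asboolP => [_|[]]; last exact: pdom.
  apply: (@le_trans _ _ (win_value t * (win_value x / win_value t * r t))).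
    by rewrite ler_wpM2l ?(ltW vt)// ge_min lexx orbT.
  by rewrite le_eqVlt; apply/orP; left; apply/eqP; field; rewrite gt_eqF.
have fs : superharmonic 1 cond [set x] f.
  split=> // [t ->|s sx {cq}q cq].
    rewrite /f; case: asboolP => // _; rewrite /r reachT// mulr1 divff ?minxx//.
    by rewrite gt_eqF//; case: Dx.
  have dq := house_distr hC cq; rewrite mul1r /f; case: asboolP => [Ds|_]; last first.
    by case/andP: (Ex_01 dq f01).
  rewrite le_min; apply/andP; split; first by case/andP: (Ex_01 dq f01).
  have [p [pp pv pdom ->]] := cond_dom Ds cq; have dp := pure_dist pp.
  have s0 := Ds.1; rewrite Ex_doob//; last exact: bnd01.
  rewrite [leRHS]mulrAC [leRHS]mulrC ler_wpM2l ?invr_ge0 ?(ltW s0)//.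
  apply: le_trans (vf s p dp pv pdom) _; rewrite ler_wpM2l//; first by case/andP: (v01 x).
  by rewrite /r; apply: reach_step.
have dq := house_distr hC cq.
have [p [pp pv pdom qE]] := cond_dom Dx cq; have dp := pure_dist pp.
apply: le_trans (kP p pp).
apply: (@le_trans _ _ (Ex q f)).
  apply: Ex_le => // [||t _]; [exact: bnd_reach|exact: bnd01|].
  exact: reach_le.
have x0 := Dx.1; rewrite qE Ex_doob//; last exact: bnd01.
by rewrite ler_pdivrMl//; exact: vf dp pv pdom.
Qed.

Let Z := [set s | opt_state s /\ color 0 s].
(** States outside [opt_state] are absorbing after conditioning, so they have to count as
    targets. *)
Let Y := [set s | ~ opt_state s \/ color 2 s].
Let u := safe cond Z.
Let u01 s : 0 <= u s <= 1 := safe01 Z hC s.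
Let T := Y `|` [set t | 7 / 8 <= u t].

Let G0 : set (nat -> S) := [set r | forall n, color 0 (r n)].

Let mG0 : mevent G0.
Proof.
have -> : G0 = \bigcap_n [set r | color 0 (r n)].
  by apply/seteqP; split=> r h n; [move=> _|]; exact: h.
by apply: mevent_bigcap => n; exact: mevent_coord.
Qed.

Let G0_win : G0 `<=` win.
Proof. by move=> r Gr; right; exists 0%N => n _; exact: Gr. Qed.

(** The supremum of the probability of [G0] over optimal strategies, divided by the value, is
    [subsafe] in the conditioned house: residuals of optimal strategies are optimal, and [cond_mix]
    replaces a randomised first step. The quotient is at most 1 because [G0] implies winning. *)
Lemma opt_always0 sigma s : optimal sigma s -> opt_state s -> pr sigma s G0 <= win_value s * u s.
Proof.
move=> os Ds; pose P t := [set pr tau t G0 | tau in [set tau : strategy M | optimal tau t]].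
pose f t := if `[< opt_state t >] then (win_value t)^-1 * sup (P t) else 0.
have prP t tau : optimal tau t -> pr tau t G0 <= win_value t.
  by move=> ot; rewrite -ot; apply: le_pr.
have ubP t : has_ubound (P t) by exists (win_value t) => _ [tau ot <-]; exact: prP.
have P0 t : opt_state t -> P t !=set0.
  by move=> [_ [tau ot]]; exists (pr tau t G0), tau.
have supP t tau : optimal tau t -> pr tau t G0 <= sup (P t).
  by move=> ot; apply: ub_le_sup => //; exists tau.
have sup_ge0 t : opt_state t -> 0 <= sup (P t).
  move=> [_ [tau ot]]; apply: le_trans (supP t tau ot).
  by case/andP: (pr01 tau t mG0).
have f01 t : 0 <= f t <= 1.
  rewrite /f; case: asboolP => [Dt|_]; last by rewrite lexx ler01.
  have t0 := Dt.1; rewrite mulr_ge0 ?invr_ge0 ?(ltW t0) ?sup_ge0//= mulrC ler_pdivrMr// mul1r.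
  by apply: ge_sup; [exact: P0|move=> _ [tau ot <-]; exact: prP].
have vf t : opt_state t -> win_value t * f t = sup (P t).
  move=> Dt; rewrite /f; case: asboolP => // _.
  by rewrite mulrA divff ?mul1r// gt_eqF//; case: Dt.
have fp : subsafe cond Z f.
  split=> // [t Zt|t e e0].
    rewrite /f; case: asboolP => // Dt.
    suff -> : sup (P t) = 0 by rewrite mulr0.
    apply/eqP; rewrite eq_le sup_ge0// andbT; apply: ge_sup; first exact: P0.
    move=> _ [tau ot <-]; rewrite pr0_start// => r rt /(_ 0%N).
    by rewrite rt => ?; apply: Zt; split.
  have [Dt|Dt] := pselect (opt_state t); last first.
    have [[q cq] _] := hC t; exists q => //.
    rewrite {1}/f; case: asboolP => // _; rewrite addr_ge0 ?(ltW e0)//.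
    by case/andP: (Ex_01 (house_distr hC cq) f01).
  have t0 := Dt.1; have et : 0 < e / 2 * win_value t by rewrite mulr_gt0// divr_gt0.
  have [|_ [tau ot <-] ht] := @sup_adherent _ (P t) _ et; first by split; [exact: P0|].
  have e20 : 0 < e / 2 by lra.
  have [q cq qf] := cond_mix Dt ot f01 e20; exists q => //.
  rewrite -(ler_pM2l t0) vf//.
  have : pr tau t G0 <= win_value t * (Ex q f + e / 2).
    apply: le_trans qf; rewrite pr_step//.
    have dp := nd_dist tau [::] t.
    apply: Ex_le => // [||w pw].
    - by apply: (@bpr tau (fun=> after tau t)); exact: mevent_scons.
    - exact: bvalf.
    have ow := opt_after ot pw.
    apply: (@le_trans _ _ (pr (after tau t) w G0)).
      apply: le_pr => //; first exact: mevent_scons.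
      by move=> r Gr n; exact: (Gr n.+1).
    have := v01 w; rewrite le_eqVlt => /andP[/predU1P[w0 _|w0 _]].
      by rewrite -w0 mul0r w0; exact: prP.
    by rewrite vf; [exact: supP|exact: opt_dom pw w0].
  by move: ht; rewrite mulrDr; nra.
apply: (@le_trans _ _ (win_value s * f s)); first by rewrite vf//; exact: supP.
rewrite ler_wpM2l//; first by case/andP: (v01 s).
exact: le_safe.
Qed.

Let offT s : ~ T s -> [/\ opt_state s, ~ color 2 s & u s < 7 / 8].
Proof.
move=> Ts; split.
- by apply: contrapT => Ds; apply: Ts; left; left.
- by move=> c2; apply: Ts; left; right.
- by rewrite ltNge; apply/negP => us; apply: Ts; right.
Qed.

(** A winning sequence that never visits [T] misses color 2, so it lies in some [K m]. *)
Let K m : set (nat -> S) :=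
  [set r | (forall n, ~ T (r n)) /\ (forall n, (m <= n)%N -> color 0 (r n))].

Let mK m : mevent (K m).
Proof.
have -> : K m = \bigcap_n [set r | ~ T (r n) /\ ((m <= n)%N -> color 0 (r n))].
  apply/seteqP; split=> r; first by move=> [h h'] n _; split; [exact: h|exact: h'].
  by move=> h; split=> n; have [] := h n I.
apply: mevent_bigcap => n.
exact: (mevent_coord n (fun t => ~ T t /\ ((m <= n)%N -> color 0 t))).
Qed.

Let K0 n : set (nat -> S) :=
  [set r | forall i, (i < n)%N -> ~ T (r i) /\ color 0 (r i)].

Let mK0 n : mevent (K0 n).
Proof.
have -> : K0 n = \bigcap_i [set r | (i < n)%N -> ~ T (r i) /\ color 0 (r i)].
  by apply/seteqP; split=> r h i; [move=> _|]; exact: h.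
apply: mevent_bigcap => i.
exact: (mevent_coord i (fun t => (i < n)%N -> ~ T t /\ color 0 t)).
Qed.

(* Off [T] the probability of staying in color 0 is at most 7/8, whatever the
   history, so that this probability [x] satisfies [x <= 7 / 8 * x]. *)
Lemma opt_avoid0 n sigma s : optimal sigma s ->
  pr sigma s (K 0%N) <= 7 / 8 * pr sigma s (K0 n).
Proof.
elim: n sigma s => [|n IH] sigma s os.
  have [Ts|/offT[Ds _ us]] := pselect (T s).
    rewrite pr0_start//; last by move=> r rs [/(_ 0%N)]; rewrite rs.
    by rewrite mulr_ge0//; case/andP: (pr01 sigma s (mK0 0)).
  have -> : K0 0 = setT by apply/seteqP; split.
  rewrite pr_setT mulr1; apply: (@le_trans _ _ (pr sigma s G0)).
    by apply: le_pr => // r [_ h] k; exact: h.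
  apply: le_trans (opt_always0 os Ds) _.
  by have := v01 s; have := u01 s; nra.
have [[Ts cs]|nK] := pselect (~ T s /\ color 0 s); last first.
  rewrite pr0_start//; first by rewrite mulr_ge0//; case/andP: (pr01 sigma s (mK0 n.+1)).
  by move=> r rs [/(_ 0%N) + /(_ 0%N isT)]; rewrite rs => ? ?; apply: nK.
have dp := nd_dist sigma [::] s.
rewrite !pr_step// -ExZ//; last by apply: (@bpr sigma (fun=> after sigma s)); exact: mevent_scons.
apply: Ex_le => // [||t pt].
- by apply: (@bpr sigma (fun=> after sigma s)); exact: mevent_scons.
- by apply: bndZ; apply: (@bpr sigma (fun=> after sigma s)); exact: mevent_scons.
have ot := opt_after os pt; apply: le_trans (le_trans (IH _ _ ot) _).
  apply: le_pr; [exact: mevent_scons|exact: mK|].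
  by move=> r [h h']; split=> i; [exact: (h i.+1)|move=> _; exact: (h' i.+1)].
rewrite ler_wpM2l//; apply: le_pr => //; first exact: mevent_scons.
by move=> r h [|i] //; exact: h.
Qed.

Lemma opt_avoid m sigma s : optimal sigma s -> pr sigma s (K m) = 0.
Proof.
elim: m sigma s => [|m IH] sigma s os; apply/eqP; rewrite eq_le.
  have /andP[k0 _] := pr01 sigma s (mK 0); rewrite k0 andbT.
  suff : 8 / 7 * pr sigma s (K 0) <= pr sigma s (K 0) by lra.
  apply: (@le_trans _ _ (pr sigma s (\bigcap_n K0 n))).
    apply: pr_bigcap_ge => // [i j ij r h k ki|n]; first exact/h/(leq_trans ki).
    by have := @opt_avoid0 n _ _ os; lra.
  apply: le_pr => //; first exact: mevent_bigcap.
  by move=> r h; split=> [n|n _]; have [] := h n.+1 I n (ltnSn n).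
(* A step lowers the delay from [m.+1] to [m], and the residual strategy is still optimal. *)
have /andP[-> _] := pr01 sigma s (mK m.+1); rewrite andbT.
rewrite pr_step//; apply: Ex_le_cst => [||t pt]; first exact: nd_dist.
  by apply: (@bpr sigma (fun=> after sigma s)); exact: mevent_scons.
rewrite -(IH _ _ (opt_after os pt)); apply: le_pr; [exact: mevent_scons|exact: mK|].
by move=> r [h h']; split=> i; [exact: (h i.+1)|move=> mi; exact: (h' i.+1)].
Qed.

Let hit n : set (nat -> S) := [set r | exists2 k, (k <= n)%N & T (r k)].

Let mhit n : mevent (hit n).
Proof.
have -> : hit n = \bigcup_k [set r | (k <= n)%N /\ T (r k)].
  by apply/seteqP; split=> r [k]; [exists k|move=> _ []; exists k].
apply: mevent_bigcup => k; exact: (mevent_coord k (fun t => (k <= n)%N /\ T t)).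
Qed.

(** Off [T], [win_value * f] is a supermartingale under optimal strategies, since the error in
    [cond_mix] is arbitrary; on [T] it is the value, which bounds the probability of winning. *)
Lemma opt_hit f n sigma s : superharmonic 1 cond T f -> optimal sigma s ->
  pr sigma s (win `&` hit n) <= win_value s * f s.
Proof.
move=> [f01 fT fS]; have mWH n' := meventI mwin (mhit n').
elim: n sigma s => [|n IH] sigma s os; have [Ts|Ts] := pselect (T s).
- by rewrite fT// mulr1 -os; apply: le_pr => // r [].
- rewrite pr0_start//.
    by rewrite mulr_ge0//; [case/andP: (v01 s)|case/andP: (f01 s)].
  by move=> r rs [_ [k]]; rewrite leqn0 => /eqP ->; rewrite rs.
- by rewrite fT// mulr1 -os; apply: le_pr => // r [].
have [Ds _ _] := offT Ts; have s0 := Ds.1.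
apply/ler_addgt0Pr => e e0.
have es : 0 < e / win_value s by rewrite divr_gt0.
have [q cq qf] := cond_mix Ds os f01 es.
have qs : Ex q f <= f s by rewrite -[leLHS]mul1r; exact: fS.
apply: (@le_trans _ _ (win_value s * (Ex q f + e / win_value s))); last first.
  by rewrite mulrDr mulrCA divff ?mulr1 ?gt_eqF// lerD2r ler_wpM2l// ltW.
apply: le_trans qf; rewrite pr_step//; apply: Ex_le => // [|||t pt].
- exact: nd_dist.
- by apply: (@bpr sigma (fun=> after sigma s)); exact: mevent_scons.
- exact: bvalf.
apply: le_trans (IH _ _ (opt_after os pt)); apply: le_pr => //; first exact: mevent_scons.
rewrite preimage_setI scons_win => r [wr [[|k] kn Tk]]; first by [].
by split=> //; exists k.
Qed.

(** Up to the null sets [K m], winning entails a visit to [T]. So [opt_hit] yields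
    [win_value s <= win_value s * f s] for each competitor [f], and the positive value cancels. *)
Lemma cond_reach s : reach cond T s = 1.
Proof.
have one01 : 0 <= (1 : R) <= 1 by rewrite ler01 lexx.
apply/eqP; rewrite eq_le; have /andP[_ ->] := reach01 hC T s.
apply: dreach_ge => // f sf; have [f01 fT fS] := sf.
have [Ts|Ts] := pselect (T s); first by rewrite fT.
have [Ds _ _] := offT Ts; have [s0 [sigma os]] := Ds.
rewrite -(ler_pM2l s0) mulr1 -[leLHS]os.
have mWH n := meventI mwin (mhit n).
have mU : mevent (\bigcup_n (win `&` hit n)) by exact: mevent_bigcup.
have mV : mevent (\bigcup_m K m) by exact: mevent_bigcup.
apply: (@le_trans _ _ (pr sigma s ((\bigcup_n (win `&` hit n)) `|` \bigcup_m K m))).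
  apply: le_pr => //; first exact: meventU.
  move=> r wr; have [[n Tn]|nT] := pselect (exists n, T (r n)).
    by left; exists n => //; split=> //; exists n.
  right; case: wr => [/(_ 0%N)[n [_ c2]]|[m hm]].
    by case: nT; exists n; left; right.
  by exists m => //; split=> // n Tn; apply: nT; exists n.
apply: le_trans (prU _ _ mU mV) _.
rewrite [X in _ + X]pr_bigcup0// ?addr0; last by move=> m; exact: opt_avoid.
apply: pr_bigcup_le => // [i j ij r [wr [k ki Tk]]|n]; last exact: opt_hit.
by split=> //; exists k => //; exact: leq_trans ij.
Qed.

End conditioned.

(** * The memoryless strategy *)

Section memoryless.
Variables (R : realType) (S : countType) (M : mdp R S) (col : S -> 'I_3).

Local Notation win := (win col).
Local Notation win_value := (win_value M col).
Local Notation opt_state := (opt_state M col).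
Local Notation cond := (cond M col).
Local Notation color := (color col).

Variables (b a : S -> S -> R) (g : S -> R).
Hypotheses (pb : forall s, pure M s (b s)) (ca : forall s, cond s (a s)).
Hypothesis ab : forall s, opt_state s -> [/\ Ex (b s) win_value = win_value s,
  forall t, 0 < b s t -> 0 < win_value t -> opt_state t & a s = doob M col s (b s)].
Hypotheses (g01 : forall s, 0 <= g s <= 1)
  (gZ : forall s, ~ (opt_state s /\ color 0 s) -> g s = 0)
  (ga : forall s, g s <= Ex (a s) g).

Let T := [set s | ~ opt_state s \/ color 2 s] `|` [set t | 1 / 2 <= g t].
Hypothesis rT : forall s, reach (fun s => [set a s]) T s = 1.

Let tau : strategy M := strategy_of (fun _ s => pure_legal (pb s)).
Let v01 s : 0 <= win_value s <= 1 := win_value01 M col s.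
Let bval : bnd win_value := bnd01 v01.
Let db s : dist (b s) := pure_dist (pb s).
Let hC : house cond := @cond_house R S M col.

Let bpr E : mevent E -> bnd (fun t => pr tau t E).
Proof. by move=> mE; apply: bnd01 => t; exact: pr01. Qed.

Let pr_tau_step s E : mevent E ->
  pr tau s E = Ex (b s) (fun t => pr tau t (scons s @^-1` E)).
Proof.
by move=> mE; rewrite pr_step// strategy_ofE.
Qed.

(* Winning, except that the limit color 2 is only required [k] times. *)
Definition win_upto k : set (nat -> S) := eventually0 col `|`
  [set r | exists n, (k <= count (fun t => col t == 2%N :> nat) (mkseq r n))%N].

Lemma mevent_win_upto k : mevent (win_upto k).
Proof.
apply: meventU; first exact: mevent_eventually0.
have -> : [set r : nat -> S | exists n, (k <= count (fun t => col t == 2%N :> nat) (mkseq r n))%N]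
  = \bigcup_n [set r | (k <= count (fun t => col t == 2%N :> nat) (mkseq r n))%N].
  by apply/seteqP; split=> r [n]; [exists n|move=> _; exists n].
apply: mevent_bigcup => n.
exact: (mevent_mkseq n (fun w => (k <= count (fun t => col t == 2%N :> nat) w)%N)).
Qed.

Lemma win_upto_scons s k r : win_upto k r ->
  win_upto ((col s == 2%N :> nat) + k)%N (scons s r).
Proof.
move=> [e0|[n kn]]; [left|right].
  by rewrite -[_ (scons s r)]/((scons s @^-1` eventually0 col) r) scons_eventually0.
by exists n.+1; rewrite mkseq_recl /= leq_add2l.
Qed.

Lemma win_uptoS s k r : win_upto k r -> win_upto k (scons s r).
Proof.
move=> /(win_upto_scons s)[e0|[n kn]]; [by left|right].
by exists n; apply: leq_trans kn; exact: leq_addl.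
Qed.

Lemma win_upto_win : \bigcap_k win_upto k `<=` win.
Proof.
move=> r h; have [e0|ne0] := pselect (eventually0 col r); first by right.
(* Color 2 seen [m.+1] times does not fit into the first [m] states. *)
left => m; have [//|[n mn]] := h m.+1 I.
apply: contrapT => /forallNP nc.
have count0 k : count (fun t => col t == 2%N :> nat) [seq r i | i <- iota m k] = 0%N.
  apply/eqP; rewrite -leqn0 leqNgt -has_count; apply/hasP => -[_ /mapP[i + ->] c2].
  by rewrite mem_iota => /andP[mi _]; apply: (nc i); split=> //; exact/eqP.
have : (n < m \/ exists k, n = m + k)%N.
  by case: (ltnP n m) => [|mn']; [left|right; exists (n - m)%N; rewrite subnKC].
move: mn => /[swap] -[nm|[k ->]].
  by rewrite leqNgt ltnS (leq_trans (count_size _ _))// size_mkseq ltnW.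
rewrite /mkseq iotaD map_cat count_cat count0 addn0 => mn.
have := leq_trans mn (count_size _ _); rewrite size_map size_iota ltnn.
by [].
Qed.

Section step.
Variable k : nat.
Hypothesis IH : forall s, opt_state s -> win_value s <= pr tau s (win_upto k).
Let d s := pr tau s (win_upto k.+1).
Let mW : mevent (win_upto k.+1) := mevent_win_upto k.+1.
Let d0 s : 0 <= d s. Proof. by case/andP: (pr01 tau s mW). Qed.
Let bd : bnd d := bpr mW.

(* The constant [c] is the best lower bound for [d / win_value]; it improves to
   [(1 + c) / 2] on [T], hence everywhere since [T] is reached. *)
Let phi s := if `[< opt_state s >] then Num.min 1 (d s / win_value s) else 1.
Let c := inf (range phi).

Let phi01 s : 0 <= phi s <= 1.
Proof.
rewrite /phi; case: asboolP => [Ds|_]; last by rewrite ler01 lexx.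
rewrite ge_min lexx/= andbT le_min ler01/= divr_ge0//.
by case/andP: (v01 s).
Qed.

Let c_le s : c <= phi s.
Proof.
apply: ge_inf; last by exists s.
by exists 0 => _ [t _ <-]; case/andP: (phi01 t).
Qed.

Let d_phi s : opt_state s -> win_value s * phi s <= d s.
Proof.
move=> Ds; have s0 := Ds.1; rewrite mulrC -ler_pdivlMr// /phi.
by case: asboolP => // _; rewrite ge_min lexx orbT.
Qed.

Let c0 (s : S) : 0 <= c.
Proof.
by apply: lb_le_inf; [exists (phi s), s|move=> _ [t _ <-]; case/andP: (phi01 t)].
Qed.

Let c1 (s : S) : c <= 1.
Proof. by apply: le_trans (c_le s) _; case/andP: (phi01 s). Qed.

(** Successors of [s] outside [opt_state] have value 0, so there an estimate of the value has to be
    checked at 0 only. *)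
Let b_dom s t (P : R -> Prop) : opt_state s -> 0 < b s t -> P 0 -> (opt_state t -> P (win_value t)) ->
  P (win_value t).
Proof.
move=> Ds bt P0 Pt; have [_ bdom _] := ab Ds.
have := v01 t; rewrite le_eqVlt => /andP[/predU1P[<- //|vt _]].
exact/Pt/bdom.
Qed.

Let d_step s : Ex (b s) d <= d s.
Proof.
rewrite [leRHS]pr_tau_step//; apply: Ex_le => // [|t _].
  by apply: bpr; exact: mevent_scons.
by apply: le_pr => //; [exact: mevent_scons|move=> r /win_uptoS; exact].
Qed.

Let Q n : set (nat -> S) := [set r | forall i, (i < n)%N -> 0 < g (r i)].

Let mQ n : mevent (Q n).
Proof.
have -> : Q n = \bigcap_i [set r | (i < n)%N -> 0 < g (r i)].
  by apply/seteqP; split=> r h i; [move=> _|]; exact: h.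
apply: mevent_bigcap => i.
exact: (mevent_coord i (fun t => (i < n)%N -> 0 < g t)).
Qed.

(** The fraction [c + (1 - c) * g] is affine in the submartingale [g]. Where [g] vanishes it is the
    general bound [c]; elsewhere one more step is spent in [Q]. *)
Let d_safe_upto n s : opt_state s ->
  win_value s * (c + (1 - c) * g s) <= pr tau s (win_upto k.+1 `|` Q n).
Proof.
have mU m := meventU mW (mQ m).
elim: n s => [|n IHn] s Ds; have := c0 s; have := c1 s; have := g01 s; have s0 := Ds.1.
  have -> : win_upto k.+1 `|` Q 0 = setT by apply/seteqP; split=> // r _; right.
  by rewrite pr_setT; have := v01 s; move=> *; rewrite mulr_ile1//; nra.
move=> g01s c1' c0'.
have [gs|gs] := leP (g s) 0.
  have -> : g s = 0 by lra.
  rewrite mulr0 addr0; apply: (@le_trans _ _ (d s)).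
    by apply: le_trans (d_phi Ds); rewrite ler_wpM2l// ltW.
  by apply: le_pr => // r; left.
have [bv bdom aE] := ab Ds; have bg := bnd01 g01.
have h01 t : 0 <= c + (1 - c) * g t <= 1 by have := g01 t; nra.
have bh := bnd01 h01.
apply: (@le_trans _ _ (win_value s * Ex (a s) (fun t => c + (1 - c) * g t))).
  have da : dist (a s) by exact: (hC s).2 _ (ca s).
  rewrite ler_wpM2l ?(ltW s0)// ExD//; [|exact: bnd_cst|exact: bndZ].
  by rewrite Ex_cst// ExZ// lerD2l ler_wpM2l ?subr_ge0.
rewrite aE Ex_doob// mulrA mulfV ?gt_eqF// mul1r pr_tau_step//.
apply: Ex_le => // [||t bt].
- apply: bnd01 => t; have := v01 t; have := h01 t => /andP[? ?] /andP[? ?].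
  by rewrite mulr_ge0//= mulr_ile1.
- by apply: bpr; exact: mevent_scons.
have mSU := mevent_scons s (mU n.+1).
apply: (b_dom (P := fun x => x * (c + (1 - c) * g t) <= _) Ds bt) => [|Dt].
  by rewrite mul0r; case/andP: (pr01 tau t mSU).
apply: le_trans (IHn t Dt) _; apply: le_pr => // r.
by move=> [/win_uptoS|h]; [left|right=> -[|i] //; exact: h].
Qed.

(** Keeping [g] positive forever means color 0 forever by [gZ], which already belongs to [win_upto];
    so the events [Q n] disappear in the limit. *)
Let d_safe s : opt_state s -> win_value s * (c + (1 - c) * g s) <= d s.
Proof.
move=> Ds; have mU m := meventU mW (mQ m).
apply: (@le_trans _ _ (pr tau s (\bigcap_n (win_upto k.+1 `|` Q n)))).
  apply: pr_bigcap_ge => // [i j ij r [|h]|n]; [by left| |exact: d_safe_upto].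
  by right=> m mi; apply: h; exact: leq_trans ij.
apply: le_pr => //; first exact: mevent_bigcap.
move=> r h; have [//|nw] := pselect (win_upto k.+1 r).
left; exists 0%N => n _; have [//|/(_ n (ltnSn n)) gn] := h n.+1 I.
by apply: contrapT => nc; move: gn; rewrite gZ ?ltxx// => -[].
Qed.

(** In color 2 the present visit is counted, so [IH] yields the full value afterwards; where [g] is
    at least 1/2, [d_safe] gives the fraction [c + (1 - c) / 2]. *)
Let phi_T s : T s -> (1 + c) / 2 <= phi s.
Proof.
have c1' := c1 s; have c0' := c0 s.
rewrite /phi; case: asboolP => [Ds|_]; last by move=> _; lra.
have s0 := Ds.1; rewrite le_min; move=> Ts; apply/andP; split; first by lra.
rewrite ler_pdivlMr//; case: Ts => [[//|c2]|/= gs].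
  apply: (@le_trans _ _ (win_value s)); first by rewrite ler_piMl ?(ltW s0)//; lra.
  have [bv _ _] := ab Ds; rewrite -bv /d pr_tau_step//.
  apply: Ex_le => // [|t bt]; first by apply: bpr; exact: mevent_scons.
  have mS := mevent_scons s mW.
  apply: (b_dom (P := fun x => x <= _) Ds bt) => [|Dt].
    by case/andP: (pr01 tau t mS).
  apply: le_trans (IH Dt) _; apply: le_pr => //; first exact: mevent_win_upto.
  by move=> r /(win_upto_scons s); rewrite c2.
apply: le_trans (d_safe Ds); rewrite mulrC ler_wpM2l ?(ltW s0)//; nra.
Qed.

Lemma win_upto_step s : opt_state s -> win_value s <= pr tau s (win_upto k.+1).
Proof.
move=> Ds; have c1' := c1 s; have c0' := c0 s.
have bphi := bnd01 phi01.
(* The factor sends the bound of [phi_T] to 1, so [F] competes in the definition of [reach] and must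
   be 1 everywhere; this extends the bound to all states and forces the infimum [c] to be 1. *)
pose F t := Num.min 1 (2 / (1 + c) * phi t).
have cp : 0 < 2 / (1 + c) by rewrite divr_gt0//; lra.
have cp1 : 1 <= 2 / (1 + c) by rewrite ler_pdivlMr; lra.
have F01 t : 0 <= F t <= 1.
  rewrite /F ge_min lexx/= andbT le_min ler01 mulr_ge0 ?(ltW cp)//.
  by case/andP: (phi01 t).
have hA : house (fun s => [set a s]).
  move=> t; split; first by exists (a t).
  by move=> _ ->; exact: (hC t).2 _ (ca t).
have Fs : superharmonic 1 (fun s => [set a s]) T F.
  split=> // [t /phi_T ht|t Tt _ ->].
    apply/min_idPl; rewrite mulrAC ler_pdivlMr; last by lra.
    by lra.
  have Dt : opt_state t by apply: contrapT => Dt; apply: Tt; left; left.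
  have t0 := Dt.1; have da : dist (a t) by exact: (hC t).2 _ (ca t).
  have [bv bdom aE] := ab Dt.
  have phiS : Ex (a t) phi <= phi t.
    rewrite {2}/phi; case: asboolP => // _; rewrite le_min; apply/andP; split.
      by case/andP: (Ex_01 da phi01).
    rewrite aE Ex_doob// ler_pdivrMl// mulrC divfK ?gt_eqF//.
    apply: le_trans (d_step t); apply: Ex_le => // [|u bu].
      apply: bnd01 => u; have /andP[? ?] := v01 u; have /andP[? ?] := phi01 u.
      by rewrite mulr_ge0//= mulr_ile1.
    apply: (b_dom (P := fun x => x * phi u <= _) Dt bu) => [|Du].
      by rewrite mul0r.
    exact: d_phi.
  rewrite mul1r {2}/F le_min; apply/andP; split; first by case/andP: (Ex_01 da F01).
  apply: (@le_trans _ _ (Ex (a t) (fun u => 2 / (1 + c) * phi u))).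
    apply: Ex_le => // [||u _]; [exact: bnd01|exact: bndZ|].
    by rewrite /F ge_min lexx orbT.
  by rewrite ExZ// ler_wpM2l// ltW.
have phi_ge t : (1 + c) / 2 <= phi t.
  have := @reach_le _ _ _ T F t Fs; rewrite rT /F le_min => /andP[_].
  rewrite mulrAC ler_pdivlMr; last by lra.
  by lra.
have : (1 + c) / 2 <= c.
  by apply: lb_le_inf; [exists (phi s), s|move=> _ [t _ <-]].
move=> cc; have := d_phi Ds; have := phi_ge s; have := v01 s; rewrite -/(d s); nra.
Qed.

End step.

Lemma policy_optimal s : opt_state s -> win_value s <= pr tau s win.
Proof.
have kP k t : opt_state t -> win_value t <= pr tau t (win_upto k).
  elim: k t => [|k IHk] t Dt; last exact: win_upto_step.
  have -> : win_upto 0 = setT by apply/seteqP; split=> // r _; right; exists 0%N.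
  by rewrite pr_setT; case/andP: (v01 t).
move=> Ds; apply: (@le_trans _ _ (pr tau s (\bigcap_k win_upto k))).
  apply: pr_bigcap_ge => [n|m n mn r [e0|[i ni]]|k]; last exact: kP.
  - exact: mevent_win_upto.
  - by left.
  - by right; exists i; exact: leq_trans ni.
apply: le_pr; [|exact: mevent_win|exact: win_upto_win].
by apply: mevent_bigcap => k; exact: mevent_win_upto.
Qed.

End memoryless.

Theorem theorem10 (R : realType) (S : countType) (M : mdp R S)
    (col : S -> 'I_3) :
  universally_transient M ->
  exists sigma' : strategy M, is_MD sigma' /\
    forall s : S,
      (exists sigma : strategy M,
         Pr sigma s (parity M col) = value M (parity M col) s) ->
      Pr sigma' s (parity M col) = value M (parity M col) s.
Proof.
move=> transM; have mwin := mevent_win col; have mrun := mevent_run M.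
have PrE (sigma : strategy M) s : Pr sigma s (parity M col) = (pr sigma s (win col))%:E.
  rewrite parityE prE; last exact: meventI.
  have mRW := meventI mrun mwin.
  congr EFin; apply/eqP; rewrite eq_le; apply/andP; split.
    by apply: le_pr => // r [].
  apply: (@le_trans _ _ (pr sigma s (run M `&` win col `|` ~` run M))).
    apply: le_pr => //; first by apply: meventU => //; exact: meventC.
    by move=> r wr; have [rr|rr] := pselect (run M r); [left|right].
  apply: le_trans (prU _ _ mRW (meventC mrun)) _.
  by rewrite pr_setC// pr_run// subrr addr0.
have valE s : value M (parity M col) s = (win_value M col s)%:E.
  apply/eqP; rewrite eq_le; apply/andP; split.
    by apply: ge_ereal_sup => _ [sigma _ <-]; rewrite PrE lee_fin pr_le_win_value.
  apply/lee_addgt0Pr => e e0; have [sigma /ltW h] := win_value_approx M col s e0.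
  apply: (@le_trans _ _ (Pr sigma s (parity M col) + e%:E)%E).
    by rewrite PrE -EFinD lee_fin -lerBlDr.
  by rewrite leeD2r//; apply: ereal_sup_ubound; exists sigma.
have ret x (Zx : [set s | opt_state M col s /\ color col 0 s] x) := cond_return transM Zx.1.
have [a [g [ca g01 gZ ga rT]]] := safety_reachability_policy (@cond_house _ _ M col)
  ret (@cond_reach _ _ M col).
have /choice[b bP] : forall s, exists p, pure M s p /\ (opt_state M col s ->
    [/\ Ex p (win_value M col) = win_value M col s,
    forall t, 0 < p t -> 0 < win_value M col t -> opt_state M col t & a s = doob M col s p]).
  move=> s; have [Ds|Ds] := pselect (opt_state M col s).
    by have [p [pp pv pd ap]] := cond_dom Ds (ca s); exists p; split.
  by have [[p pp] _] := pure_house M s; exists p; split.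
have pb s := (bP s).1.
exists (strategy_of (fun _ s => pure_legal (pb s))); split.
  have /choice[f fP] : forall s, exists t, controlled M s -> b s = dirac_at R t.
    move=> s; have := pb s; rewrite /pure; case: ifP => [_ [t _ ->]|_ _]; first by exists t.
    by exists s.
  by exists f => rho s cs t; rewrite /= fP.
move=> s [sigma]; rewrite valE !PrE => -[os]; congr EFin.
apply/eqP; rewrite eq_le pr_le_win_value/=.
(* States of value 0 are not in [opt_state], but any strategy is optimal there. *)
have /andP[+ _] := win_value01 M col s; rewrite [0 <= _]le_eqVlt => /predU1P[<-|s0].
  by case/andP: (pr01 (strategy_of (fun _ s => pure_legal (pb s))) s mwin).
apply: (policy_optimal pb ca (fun s => (bP s).2) g01 gZ ga rT).
by split=> //; exists sigma.
Qed.
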